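(* Let $n\ge0$ be an integer and $x>0$. Then $$I_1^{\ast}\left(0,n+\frac12;x\right)=\frac{n!\,e^{x/2}}{\sqrt{\pi}\,x^{n+1/2}}\,K_{n+1/2}\left(\frac x2\right)\mathrm{Ein}(x)+\sum_{k=0}^{n}\binom{n}{k}\frac{(n+k)!}{x^{n+k+1}}\left\{(-1)^{n+k+1}\Gamma(-n-k,x)\,\gamma(n+k+1,-x)-H_{n+k}-\sum_{\ell=1}^{n+k}\binom{n+k}{\ell}(-x)^{-\ell}\gamma(\ell,x)\right\}.$$
   Context: For $x>0$ and $\mathrm{Re}(\mu-\kappa)>-\frac12$, define $I_1^{\ast}(\kappa,\mu;x)=\int_0^\infty e^{-xt}\,t^{\mu-\kappa-1/2}(1+t)^{\mu+\kappa-1/2}\ln\left(\frac{1+t}{t}\right)dt$. $K_\nu$ is the modified Bessel function of the second kind. $\gamma(\nu,z)=\int_0^z t^{\nu-1}e^{-t}\,dt$ ($\mathrm{Re}\,\nu>0$) and $\Gamma(\nu,z)=\int_z^\infty t^{\nu-1}e^{-t}\,dt$ are the lower and upper incomplete gamma functions. $\mathrm{Ein}(z)=\int_0^z\frac{1-e^{-t}}{t}\,dt$ is the complementary exponential integral. $H_k=\sum_{j=1}^k\frac1j$ is the $k$-th harmonic number ($H_0=0$). *)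

(* Defs.v *)
From Stdlib Require Import Reals ZArith.
From Coquelicot Require Import Coquelicot.
Open Scope R_scope.

(* The integrand may be singular at 0, so the integral is improper at both ends. *)
Definition I1star (kappa mu x : R) : R :=
  RInt_gen (fun t => exp (- x * t) * Rpower t (mu - kappa - 1 / 2)
                     * Rpower (1 + t) (mu + kappa - 1 / 2) * ln ((1 + t) / t))
    (at_right 0) (Rbar_locally p_infty).

(* Euler's integral, convergent for a > 0. *)
Definition Gamma_pos (a : R) : R :=
  RInt_gen (fun t => Rpower t (a - 1) * exp (- t))
    (at_right 0) (Rbar_locally p_infty).

Fixpoint pochhammer (a : R) (m : nat) : R :=
  match m with
  | O => 1
  | S m' => pochhammer a m' * (a + INR m')
  end.

(* 1 / Gamma(a) for every real a, through the continuation
   Gamma(a) = Gamma(a + m) / (a (a + 1) ... (a + m - 1)), with m the least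
   natural number such that a + m > 0. It vanishes at a = 0, -1, -2, ... *)
Definition rGamma (a : R) : R :=
  let m := Z.to_nat (up (- a)) in pochhammer a m / Gamma_pos (a + INR m).

(* Modified Bessel function of the first kind, for z > 0. *)
Definition BesselI (nu z : R) : R :=
  Rpower (z / 2) nu
  * Series (fun k => (z / 2) ^ (2 * k) / INR (fact k) * rGamma (nu + INR k + 1)).

Definition BesselK_quot (nu z : R) : R :=
  PI / 2 * ((BesselI (- nu) z - BesselI nu z) / sin (nu * PI)).

(* Modified Bessel function of the second kind, for z > 0; at integer orders,
   where the quotient is 0/0, it is the limit in the order. *)
Definition BesselK (nu z : R) : R :=
  if Req_EM_T (sin (nu * PI)) 0
  then real (Lim (fun mu => BesselK_quot mu z) nu)
  else BesselK_quot nu z.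

(* Incomplete gamma functions of integer order s. For integer s the integrand
   t^(s-1) e^(-t) is single-valued, so no branch has to be chosen when z < 0.
   The lower function is meant for s >= 1 and any real z ([RInt] is oriented:
   for z < 0 it is minus the integral over [z, 0]); the upper one for z > 0
   and any s. *)
Definition lower_gamma (s : Z) (z : R) : R :=
  RInt (fun t => powerRZ t (s - 1) * exp (- t)) 0 z.

Definition upper_gamma (s : Z) (z : R) : R :=
  RInt_gen (fun t => powerRZ t (s - 1) * exp (- t))
    (at_point z) (Rbar_locally p_infty).

(* The value of the integrand at the removable singularity t = 0 is irrelevant. *)
Definition Ein (z : R) : R := RInt (fun t => (1 - exp (- t)) / t) 0 z.

Definition harmonic (k : nat) : R := sum_n_m (fun j => / INR j) 1 k.

(* Main.v *)
(** Write [L(t) = ln((1+t)/t)] and [J_m] for the integral of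
    [exp(-xt) t^m L(t)] over the half-line; the binomial theorem reduces
    [I1star] to [J_n, ..., J_(2n)], and the claim holds term by term.
    Integrating the derivative of [t^(m+1) exp(-xt) L(t)] gives
    [x J_(m+1) = (m+1) J_m - M_m], where the integral [M_m] of
    [exp(-xt) t^m / (1+t)] equals [m! e^x Gamma(-m, x)]. The closed form of
    [J_m] obeys the same recurrence, by the recurrences of both incomplete gamma
    functions and because the finite sums in it increase by
    [- gamma(m+1,-x) e^(-x) / (-x)^(m+1)] from [m] to [m+1]. For [J_0], the function
    [(1 - e^(-xt)) L(t) + Ein(xt) - ln(1+t)] plus the integral of [e^(x-u)/u]
    over [[x, x(1+t)]], divided by [x], is an antiderivative.

    The coefficient of [Ein x] comes from
    [K_(n+1/2)(z) = sqrt(pi/(2z)) e^(-z) sum_k (n+k)! / (k! (n-k)! (2z)^k)]. This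
    follows from [K_(nu+1) = K_(nu-1) + (2 nu/z) K_nu] and [K_(-nu) = K_nu], which
    at half-integer orders come from [1/Gamma(a) = a/Gamma(a+1)] in the series of
    [I_nu]; at [nu = 1/2] the two series are the even and odd parts of
    [e^(-z)], up to the factor [Gamma(1/2) = sqrt pi]. *)

Require Import Defs.
From Stdlib Require Import Reals ZArith.
From Coquelicot Require Import Coquelicot.
From Stdlib Require Import Lra Lia.
Open Scope R_scope.

(** * Improper integrals over the half-line and the Euler integral *)

(* [auto_derive] exposes the recursion of [INR] when it differentiates a power. *)
Ltac refold_INR :=
  repeat match goal with
  | |- context [match ?m with 0%nat => 1 | S _ => INR ?m + 1 end] =>
      change (match m with 0%nat => 1 | S _ => INR m + 1 end) with (INR (S m))
  end.

Ltac continuous_by_derive :=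
  apply (ex_derive_continuous (K := R_AbsRing) (V := R_NormedModule)); auto_derive.

(* [ring] and [field] reject equations typed at a carrier merely convertible to [R]. *)
Ltac eq_in_R := match goal with |- @eq _ ?a ?b => change (@eq R a b) end.

(** The fundamental theorem of calculus for endpoints that are eventually positive. It serves
    [at_right 0], [at_point x] and infinity alike: nothing is asked of [F] outside the positive
    reals except its limits along the two filters. *)
Lemma is_RInt_gen_antiderivative (Fa Fb : (R -> Prop) -> Prop)
    {FFa : Filter Fa} {FFb : Filter Fb} (F f : R -> R) (la lb : R) :
  (forall t, 0 < t -> is_derive F t (f t)) ->
  (forall t, 0 < t -> continuous f t) ->
  Fa (fun a => 0 < a) -> Fb (fun b => 0 < b) ->
  filterlim F Fa (locally la) -> filterlim F Fb (locally lb) ->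
  is_RInt_gen f Fa Fb (lb - la).
Proof.
  intros HF Hf Ha Hb Hla Hlb.
  assert (Hpos : forall a b t, 0 < a -> 0 < b -> Rmin a b <= t -> 0 < t).
  { intros a b t ha hb ht. apply Rlt_le_trans with (2 := ht). now apply Rmin_glb_lt. }
  apply is_RInt_gen_ext with (Derive F).
  - apply Filter_prod with (1 := Ha) (2 := Hb). intros a b ha hb t [ht _].
    apply is_derive_unique, HF. apply (Hpos a b); [..|now left]; assumption.
  - apply is_RInt_gen_Derive; try assumption.
    + apply Filter_prod with (1 := Ha) (2 := Hb). intros a b ha hb t [ht _].
      exists (f t). apply HF, (Hpos a b); assumption.
    + apply Filter_prod with (1 := Ha) (2 := Hb). intros a b ha hb t [ht _].
      assert (h : 0 < t) by (apply (Hpos a b); assumption).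
      apply continuous_ext_loc with f; [|now apply Hf].
      (* The ball of radius [t] around [t] contains positive reals only, so [Derive F] and [f] agree
         on it. *)
      exists (mkposreal t h). intros y hy. symmetry. apply is_derive_unique, HF.
      revert hy. unfold ball; simpl; unfold AbsRing_ball, abs, minus, plus, opp; simpl.
      intros hy. apply Rabs_def2 in hy. lra.
Qed.

Lemma pinfty_pos : Rbar_locally p_infty (fun b => 0 < b).
Proof. now exists 0. Qed.

Lemma at_right0_pos : at_right 0 (fun a => 0 < a).
Proof. now exists (mkposreal 1 Rlt_0_1). Qed.

Lemma continuous_at_right (F : R -> R) (a : R) :
  continuous F a -> filterlim F (at_right a) (locally (F a)).
Proof.
  intros H. apply filterlim_filter_le_1 with (2 := H). apply filter_le_within.
Qed.

Lemma is_RInt_gen_half_line (F f : R -> R) (la lb : R) :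
  (forall t, 0 < t -> is_derive F t (f t)) ->
  (forall t, 0 < t -> continuous f t) ->
  filterlim F (at_right 0) (locally la) -> is_lim F p_infty lb ->
  is_RInt_gen f (at_right 0) (Rbar_locally p_infty) (lb - la).
Proof.
  intros HF Hf Ha Hb.
  apply is_RInt_gen_antiderivative with F; try assumption; try typeclasses eauto.
  apply at_right0_pos. apply pinfty_pos.
Qed.

Lemma is_RInt_gen_half_line_ext (f g : R -> R) (l : R) :
  (forall t, 0 < t -> f t = g t) ->
  is_RInt_gen f (at_right 0) (Rbar_locally p_infty) l ->
  is_RInt_gen g (at_right 0) (Rbar_locally p_infty) l.
Proof.
  intros H. apply is_RInt_gen_ext.
  apply Filter_prod with (1 := at_right0_pos) (2 := pinfty_pos).
  intros a b ha hb t [ht _]. apply H.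
  apply Rlt_trans with (2 := ht). now apply Rmin_glb_lt.
Qed.

(** Squeeze: the Taylor term [(x t)^(m+1) / (m+1)!] is at most [exp (x t)], which bounds the
    function by a constant times [1 / t]. *)
Lemma is_lim_pow_exp (x : R) (m : nat) :
  0 < x -> is_lim (fun t => t ^ m * exp (- x * t)) p_infty 0.
Proof.
  intros hx.
  apply is_lim_le_le_loc with (fun _ => 0)
    (fun t => INR (fact (S m)) / x ^ (S m) * / t).
  - exists 0. intros t ht.
    assert (hxm : 0 < x ^ S m) by now apply pow_lt.
    assert (htm : 0 < t ^ m) by now apply pow_lt.
    assert (hxt : 0 < x * t) by now apply Rmult_lt_0_compat.
    split.
    + apply Rlt_le, Rmult_lt_0_compat; [assumption|apply exp_pos].
    + assert (H := exp_ge_taylor (x * t) (S m) (Rlt_le _ _ hxt)).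
      rewrite tech5 in H.
      assert (H0 : 0 <= sum_f_R0 (fun k => (x * t) ^ k / INR (fact k)) m).
      { apply cond_pos_sum. intros k. apply Rlt_le, Rdiv_lt_0_compat.
        now apply pow_lt. apply INR_fact_lt_0. }
      assert (hf := INR_fact_lt_0 (S m)).
      assert (H1 : (x * t) ^ S m <= exp (x * t) * INR (fact (S m))).
      { apply Rmult_le_reg_r with (/ INR (fact (S m))). now apply Rinv_0_lt_compat.
        rewrite Rmult_assoc, Rinv_r, Rmult_1_r; [|lra]. unfold Rdiv in H. lra. }
      replace (- x * t) with (- (x * t)) by ring. rewrite exp_Ropp.
      assert (he := exp_pos (x * t)).
      apply Rmult_le_reg_r with (exp (x * t) * x ^ S m * t).
      { repeat (assumption || apply Rmult_lt_0_compat). }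
      replace (t ^ m * / exp (x * t) * (exp (x * t) * x ^ S m * t)) with ((x * t) ^ S m).
      2: { rewrite Rpow_mult_distr. simpl (t ^ S m). field. lra. }
      replace (INR (fact (S m)) / x ^ S m * / t * (exp (x * t) * x ^ S m * t))
        with (exp (x * t) * INR (fact (S m))) by (field; lra).
      exact H1.
  - apply is_lim_const.
  - replace (Finite 0) with (Rbar_mult (INR (fact (S m)) / x ^ S m) (Finite 0)).
    2: { simpl. now rewrite Rmult_0_r. }
    apply is_lim_scal_l. apply is_lim_inv with (1 := is_lim_id p_infty). easy.
Qed.

Lemma is_RInt_gen_pow_exp (x : R) (m : nat) :
  0 < x ->
  is_RInt_gen (fun t => exp (- x * t) * t ^ m) (at_right 0) (Rbar_locally p_infty)
    (INR (fact m) / x ^ (S m)).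
Proof.
  intros hx. induction m as [|m IH].
  - replace (INR (fact 0) / x ^ 1) with (0 - - (/ x) * exp (- x * 0)).
    2: { rewrite Rmult_0_r, exp_0. simpl. field. lra. }
    apply is_RInt_gen_half_line with (fun t => - (/ x) * exp (- x * t)).
    + intros t _. auto_derive. easy. simpl. field. lra.
    + intros t _. continuous_by_derive. easy.
    + apply (continuous_at_right (fun t => - (/ x) * exp (- x * t))).
      continuous_by_derive. easy.
    + assert (H := is_lim_scal_l _ (- / x) _ _ (is_lim_pow_exp x 0 hx)).
      simpl in H. rewrite Rmult_0_r in H.
      apply is_lim_ext with (2 := H). intros t. ring.
  (* Integration by parts: the derivative of [P] is the new integrand minus [(m+1)/x] times the old
     one, and [P] vanishes at both ends. *)
  - set (P := fun t => - (/ x) * (t ^ (S m) * exp (- x * t))).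
    assert (H : is_RInt_gen (fun t => exp (- x * t) * t ^ S m
                 - INR (S m) / x * (exp (- x * t) * t ^ m))
                (at_right 0) (Rbar_locally p_infty) (0 - P 0)).
    { apply is_RInt_gen_half_line with P.
      + intros t _. unfold P. auto_derive. easy.
        refold_INR. rewrite S_INR. simpl. field. lra.
      + intros t _. continuous_by_derive. easy.
      + apply continuous_at_right.
        unfold P. continuous_by_derive. easy.
      + assert (H := is_lim_scal_l _ (- / x) _ _ (is_lim_pow_exp x (S m) hx)).
        simpl Rbar_mult in H. rewrite Rmult_0_r in H. exact H. }
    assert (H2 := is_RInt_gen_plus _ _ _ _ H (is_RInt_gen_scal _ (INR (S m) / x) _ IH)).
    unfold scal, plus in H2; simpl in H2. unfold mult in H2; simpl in H2.
    replace (INR (fact (S m)) / x ^ S (S m))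
      with (0 - P 0 + INR (S m) / x * (INR (fact m) / x ^ S m)).
    2: { unfold P. rewrite fact_simpl, mult_INR. simpl. field. split; try lra. now apply pow_nonzero; lra. }
    apply is_RInt_gen_half_line_ext with (2 := H2). intros t _. simpl. ring.
Qed.

(** * The upper incomplete gamma function *)

(** Truncation at [y] of the exponential integral [E_1(x) = Gamma(0, x)]. *)
Definition E1_partial (x y : R) : R := RInt (fun t => exp (- t) / t) x y.

Lemma continuous_exp_div_pow (m : nat) (t : R) :
  0 < t -> continuous (fun t => exp (- t) / t ^ m) t.
Proof.
  intros ht. continuous_by_derive. apply pow_nonzero. lra.
Qed.

Lemma continuous_exp_div (t : R) : 0 < t -> continuous (fun t => exp (- t) / t) t.
Proof. intros ht. continuous_by_derive. lra. Qed.

Lemma ex_RInt_pos (f : R -> R) (a b : R) :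
  (forall t, 0 < t -> continuous f t) -> 0 < a -> 0 < b -> ex_RInt f a b.
Proof.
  intros Hf ha hb. apply (ex_RInt_continuous (V := R_CompleteNormedModule)).
  intros t [ht _]. apply Hf. apply Rlt_le_trans with (2 := ht). now apply Rmin_glb_lt.
Qed.

Lemma is_derive_RInt_pos (f : R -> R) (a t : R) :
  (forall t, 0 < t -> continuous f t) -> 0 < a -> 0 < t ->
  is_derive (RInt f a) t (f t).
Proof.
  intros Hf ha ht. apply (is_derive_RInt f (RInt f a) a).
  - exists (mkposreal t ht). intros y hy.
    apply (RInt_correct (V := R_CompleteNormedModule)).
    apply ex_RInt_pos; try assumption. revert hy.
    unfold ball; simpl; unfold AbsRing_ball, abs, minus, plus, opp; simpl.
    intros hy. apply Rabs_def2 in hy. lra.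
  - now apply Hf.
Qed.

Lemma is_derive_E1_partial (x t : R) :
  0 < x -> 0 < t -> is_derive (E1_partial x) t (exp (- t) / t).
Proof.
  intros hx ht. apply (is_derive_RInt_pos (fun t => exp (- t) / t)); try assumption.
  apply continuous_exp_div.
Qed.

(** On [[u, v]] one has [1/t <= 1/x], so the increment is dominated by the integral of
    [exp (- t) / x], which is explicit. *)
Lemma E1_partial_cauchy (x u v : R) :
  0 < x -> x <= u <= v ->
  Rabs (E1_partial x v - E1_partial x u) <= exp (- u) / x.
Proof.
  intros hx [hu huv]. unfold E1_partial.
  assert (Hex : forall a b, 0 < a -> 0 < b -> ex_RInt (fun t => exp (- t) / t) a b).
  { intros a b. apply ex_RInt_pos. apply continuous_exp_div. }
  replace (RInt (fun t => exp (- t) / t) x v - RInt (fun t => exp (- t) / t) x u)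
    with (RInt (fun t => exp (- t) / t) u v).
  2: { rewrite <- (RInt_Chasles (V := R_CompleteNormedModule) (fun t => exp (- t) / t) x u v)
       by (apply Hex; lra). unfold plus; simpl. eq_in_R. lra. }
  assert (HI : is_RInt (fun t => exp (- t) / x) u v (exp (- u) / x - exp (- v) / x)).
  { replace (exp (- u) / x - exp (- v) / x)
      with (minus (- exp (- v) / x) (- exp (- u) / x)).
    2: { unfold minus, plus, opp; simpl. field. lra. }
    apply (is_RInt_derive (V := R_CompleteNormedModule) (fun t => - exp (- t) / x)).
    - intros t _. auto_derive. easy. field. lra.
    - intros t _. continuous_by_derive. easy. }
  rewrite Rabs_pos_eq.
  - apply Rle_trans with (exp (- u) / x - exp (- v) / x).
    + rewrite <- (is_RInt_unique _ _ _ _ HI).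
      apply RInt_le; try assumption. apply Hex; lra. eexists; apply HI.
      intros t ht. unfold Rdiv. apply Rmult_le_compat_l. apply Rlt_le, exp_pos.
      apply Rinv_le_contravar; lra.
    + assert (0 < exp (- v) / x) by (apply Rdiv_lt_0_compat; [apply exp_pos|assumption]).
      lra.
  - apply RInt_ge_0; try assumption. apply Hex; lra.
    intros t ht. apply Rlt_le, Rdiv_lt_0_compat; [apply exp_pos|lra].
Qed.

(** The limit has no elementary value, so it is obtained from the Cauchy criterion, with
    [exp (- u) / x] as the bound on the tail. *)
Lemma ex_lim_E1_partial (x : R) :
  0 < x -> exists l : R, is_lim (E1_partial x) p_infty l.
Proof.
  intros hx.
  apply (filterlim_locally_cauchy (U := R_CompleteSpace) (F := Rbar_locally p_infty)).
  intros eps.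
  assert (H := is_lim_pow_exp 1 0 Rlt_0_1).
  assert (he : 0 < eps * x) by (apply Rmult_lt_0_compat; [apply cond_pos|assumption]).
  apply is_lim_spec in H. destruct (H (mkposreal _ he)) as [M HM]. simpl in HM.
  exists (fun u => Rmax x M < u). split. now exists (Rmax x M).
  assert (Hs : forall u v, Rmax x M < u -> u <= v ->
    Rabs (E1_partial x v - E1_partial x u) < eps).
  { intros u v hu huv. assert (h1 := Rmax_l x M). assert (h2 := Rmax_r x M).
    apply Rle_lt_trans with (exp (- u) / x). apply E1_partial_cauchy; lra.
    apply Rmult_lt_reg_r with x. assumption. unfold Rdiv.
    rewrite Rmult_assoc, Rinv_l, Rmult_1_r by lra.
    apply Rle_lt_trans with (2 := HM u ltac:(lra)).
    rewrite Rminus_0_r, Rmult_1_l.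
    replace (-1 * u) with (- u) by ring. replace (- (1) * u) with (- u) by ring.
    apply Rle_abs. }
  intros u v hu hv.
  unfold ball; simpl; unfold AbsRing_ball, abs, minus, plus, opp; simpl.
  change (Rabs (E1_partial x v - E1_partial x u) < eps).
  destruct (Rle_lt_dec u v) as [h|h].
  - now apply Hs.
  - rewrite Rabs_minus_sym. apply Hs; [assumption|lra].
Qed.

Lemma powerRZ_opp_nat (t : R) (m : nat) : powerRZ t (- Z.of_nat m) = / t ^ m.
Proof.
  destruct m as [|m]; simpl. now rewrite Rinv_1.
  now rewrite SuccNat2Pos.id_succ.
Qed.

Lemma upper_gamma_unique (m : nat) (x l : R) :
  0 < x ->
  is_RInt_gen (fun t => exp (- t) / t ^ S m) (at_point x) (Rbar_locally p_infty) l ->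
  upper_gamma (- Z.of_nat m) x = l.
Proof.
  intros hx H. unfold upper_gamma.
  apply is_RInt_gen_unique; try (apply Proper_StrongProper; typeclasses eauto).
  apply is_RInt_gen_ext with (2 := H).
  apply Filter_prod with (fun a => a = x) (fun b => 0 < b).
  reflexivity. apply pinfty_pos.
  intros a b -> hb t [ht _]. simpl in ht.
  replace (- Z.of_nat m - 1)%Z with (- Z.of_nat (S m))%Z by lia.
  rewrite powerRZ_opp_nat. apply Rmult_comm.
Qed.

(** Integrate the derivative of [- exp (- t) / t ^ S m] from [x] to infinity. Phrased with
    [is_RInt_gen], it carries convergence along with the value, so that only [m = 0] calls for an
    existence argument. *)
Lemma upper_gamma_recurrence (m : nat) (x l : R) :
  0 < x ->
  is_RInt_gen (fun t => exp (- t) / t ^ S m) (at_point x) (Rbar_locally p_infty) l ->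
  is_RInt_gen (fun t => exp (- t) / t ^ S (S m)) (at_point x) (Rbar_locally p_infty)
    ((exp (- x) / x ^ S m - l) / INR (S m)).
Proof.
  intros hx H. assert (hm := lt_0_INR (S m) ltac:(lia)).
  set (F := fun t => - (exp (- t) / t ^ S m)).
  assert (HF : is_RInt_gen (fun t => exp (- t) / t ^ S m
                + INR (S m) * (exp (- t) / t ^ S (S m)))
                (at_point x) (Rbar_locally p_infty) (0 - F x)).
  { apply (is_RInt_gen_antiderivative _ _ F).
    - intros t ht. unfold F. assert (0 < t ^ m) by now apply pow_lt.
      auto_derive. simpl. apply Rmult_integral_contrapositive; lra.
      refold_INR. rewrite S_INR. simpl. field. lra.
    - intros t ht. assert (0 < t ^ m) by now apply pow_lt.
      continuous_by_derive. simpl. repeat split; try easy; repeat apply Rmult_integral_contrapositive_currified; lra.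
    - exact hx.
    - apply pinfty_pos.
    - intros P HP. now apply locally_singleton in HP.
    (* Both factors tend to 0: the exponential, and the inverse power, which is at most [1 / t] for
       [t > 1]. *)
    - assert (H0 : is_lim (fun t => - (t ^ 0 * exp (- 1 * t)) * / t ^ S m) p_infty 0).
      { replace (Finite 0) with (Rbar_mult (Rbar_opp 0) 0) by (simpl; f_equal; ring).
        apply is_lim_mult; [..|easy].
        - apply is_lim_opp, is_lim_pow_exp, Rlt_0_1.
        - apply is_lim_le_le_loc with (fun _ => 0) (fun t => / t).
          + exists 1. intros t ht. assert (1 <= t ^ m) by (apply pow_R1_Rle; lra).
            simpl. split. apply Rlt_le, Rinv_0_lt_compat. apply Rmult_lt_0_compat; lra.
            apply Rinv_le_contravar. lra. rewrite <- (Rmult_1_r t) at 1.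
            apply Rmult_le_compat_l; lra.
          + apply is_lim_const.
          + apply is_lim_inv with (1 := is_lim_id p_infty). easy. }
      apply is_lim_ext with (2 := H0). intros t. unfold F, Rdiv. simpl pow at 1.
      replace (-1 * t) with (- t) by ring. ring. }
  assert (H2 := is_RInt_gen_scal _ (/ INR (S m)) _ (is_RInt_gen_minus _ _ _ _ HF H)).
  unfold scal, minus, plus, opp in H2; simpl in H2. unfold mult in H2; simpl in H2.
  replace ((exp (- x) / x ^ S m - l) / INR (S m)) with (/ INR (S m) * (0 - F x + - l)).
  2: { unfold F. assert (x ^ S m <> 0) by (apply pow_nonzero; lra). field. split; (assumption || lra). }
  apply is_RInt_gen_ext with (2 := H2).
  apply Filter_prod with (fun a => a = x) (fun b => 0 < b).
  reflexivity. apply pinfty_pos.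
  intros a b -> hb t [ht _]. simpl in ht.
  assert (h : 0 < t) by (apply Rlt_trans with (2 := ht); now apply Rmin_glb_lt).
  change (match m with O => 1 | S _ => INR m + 1 end) with (INR (S m)).
  eq_in_R. rewrite <- !tech_pow_Rmult. assert (t ^ m <> 0) by (apply pow_nonzero; lra).
  field. repeat split; (assumption || lra).
Qed.

Lemma is_lim_E1_partial (x : R) :
  0 < x -> is_lim (E1_partial x) p_infty (upper_gamma 0 x).
Proof.
  intros hx. destruct (ex_lim_E1_partial x hx) as [l Hl].
  replace (upper_gamma 0 x) with l; [assumption|]. symmetry.
  apply (upper_gamma_unique 0 x l hx).
  replace l with (l - E1_partial x x).
  2: { unfold E1_partial. rewrite RInt_point. unfold zero; simpl. eq_in_R. ring. }
  apply (is_RInt_gen_antiderivative _ _ (E1_partial x)); try assumption.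
  - intros t ht. simpl. rewrite Rmult_1_r. now apply is_derive_E1_partial.
  - apply continuous_exp_div_pow.
  - apply pinfty_pos.
  - intros P HP. now apply locally_singleton in HP.
Qed.

Lemma is_RInt_gen_upper_gamma (m : nat) (x : R) :
  0 < x ->
  is_RInt_gen (fun t => exp (- t) / t ^ S m) (at_point x) (Rbar_locally p_infty)
    (upper_gamma (- Z.of_nat m) x).
Proof.
  intros hx.
  assert (H : exists l, is_RInt_gen (fun t => exp (- t) / t ^ S m)
                          (at_point x) (Rbar_locally p_infty) l).
  { induction m as [|m [l IH]].
    - exists (upper_gamma 0 x - E1_partial x x).
      apply (is_RInt_gen_antiderivative _ _ (E1_partial x)); try assumption.
      + intros t ht. simpl. rewrite Rmult_1_r. now apply is_derive_E1_partial.
      + apply continuous_exp_div_pow.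
      + apply pinfty_pos.
      + intros P HP. now apply locally_singleton in HP.
      + now apply is_lim_E1_partial.
    - eexists. now apply upper_gamma_recurrence with (2 := IH). }
  destruct H as [l Hl]. now rewrite (upper_gamma_unique m x l).
Qed.

Lemma upper_gamma_succ (m : nat) (x : R) :
  0 < x ->
  upper_gamma (- Z.of_nat (S m)) x
  = (exp (- x) / x ^ S m - upper_gamma (- Z.of_nat m) x) / INR (S m).
Proof.
  intros hx. apply upper_gamma_unique. assumption.
  apply upper_gamma_recurrence. assumption. now apply is_RInt_gen_upper_gamma.
Qed.

(** * The complementary exponential integral and the logarithmic kernel *)

(* The continuous extension of the integrand of [Ein], which is junk at [0]. *)
Definition Ein_integrand (t : R) : R :=
  if Req_EM_T t 0 then 1 else (1 - exp (- t)) / t.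

Lemma Ein_integrand_pos (t : R) : 0 < t -> Ein_integrand t = (1 - exp (- t)) / t.
Proof.
  intros ht. unfold Ein_integrand. destruct (Req_EM_T t 0); [lra|reflexivity].
Qed.

Lemma continuous_Ein_integrand (t : R) : continuous Ein_integrand t.
Proof.
  destruct (Req_EM_T t 0) as [->|ht].
  - apply continuity_pt_filterlim, continuity_pt_filterlim'.
    unfold Ein_integrand at 2. destruct (Req_EM_T 0 0) as [_|h]; [|easy].
    change (is_lim Ein_integrand 0 1).
    (* Continuity at 0 is the derivative of [exp] there, read at [- t]. *)
    apply is_lim_ext_loc with (fun t => (exp (- t) - 1) / (- t)).
    + exists (mkposreal 1 Rlt_0_1). intros y _ hy. unfold Ein_integrand.
      destruct (Req_EM_T y 0); [easy|]. field. assumption.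
    + apply (is_lim_comp (fun y => (exp y - 1) / y) Ropp 0 1 0).
      * apply is_lim_div_expm1_0.
      * assert (H := is_lim_opp _ _ _ (is_lim_id 0)).
        simpl in H. now rewrite Ropp_0 in H.
      * exists (mkposreal 1 Rlt_0_1). intros y _ hy H. apply hy.
        injection H. lra.
  - apply continuous_ext_loc with (fun t => (1 - exp (- t)) / t).
    + assert (h : 0 < Rabs t) by now apply Rabs_pos_lt.
      exists (mkposreal _ h). intros y hy. unfold Ein_integrand.
      destruct (Req_EM_T y 0) as [->|_]; [|reflexivity].
      revert hy. unfold ball; simpl; unfold AbsRing_ball, abs, minus, plus, opp; simpl.
      rewrite Rplus_0_l, Rabs_Ropp. lra.
    + continuous_by_derive. easy.
Qed.

(** The two integrands differ only at 0, an endpoint, which the integral does not see. *)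
Lemma Ein_RInt (z : R) : Ein z = RInt Ein_integrand 0 z.
Proof.
  apply RInt_ext. intros t ht. unfold Ein_integrand.
  destruct (Req_EM_T t 0) as [->|_]; [|reflexivity].
  exfalso. destruct (Rle_lt_dec 0 z) as [h|h].
  - rewrite Rmin_left in ht by assumption. lra.
  - rewrite Rmax_left in ht by lra. lra.
Qed.

Lemma is_derive_Ein (z : R) : is_derive Ein z (Ein_integrand z).
Proof.
  apply is_derive_ext with (RInt Ein_integrand 0).
  { intros t. symmetry. apply Ein_RInt. }
  apply (is_derive_RInt Ein_integrand (RInt Ein_integrand 0) 0).
  - apply filter_forall. intros b. apply (RInt_correct (V := R_CompleteNormedModule)).
    apply (ex_RInt_continuous (V := R_CompleteNormedModule)).
    intros t _. apply continuous_Ein_integrand.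
  - apply continuous_Ein_integrand.
Qed.

Lemma Ein_0 : Ein 0 = 0.
Proof. unfold Ein. now rewrite RInt_point. Qed.

(** The derivative [(1 - e^(-t))/t - 1/t + e^(-t)/t] of [Ein t - ln t + E1_partial x t] is zero.
    This isolates the logarithmic growth of [Ein], which has to cancel at infinity. *)
Lemma Ein_E1_partial (x y : R) :
  0 < x <= y -> Ein y = Ein x + (ln y - ln x) - E1_partial x y.
Proof.
  intros [hx [hxy| <-]].
  2: { unfold E1_partial. rewrite RInt_point. unfold zero; simpl. eq_in_R. ring. }
  assert (H : Ein x - ln x + E1_partial x x = Ein y - ln y + E1_partial x y).
  { apply (eq_is_derive (fun t => Ein t - ln t + E1_partial x t)); [|assumption].
    intros t ht.
    replace (@zero R_NormedModule) with (Ein_integrand t - / t + exp (- t) / t).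
    2: { rewrite Ein_integrand_pos by lra. unfold zero; simpl. eq_in_R. field. lra. }
    apply (is_derive_plus (fun t => Ein t - ln t)).
    - apply (is_derive_minus Ein ln). apply is_derive_Ein.
      apply is_derive_ln. lra.
    - apply is_derive_E1_partial; lra. }
  unfold E1_partial at 1 in H. rewrite RInt_point in H. unfold zero in H; simpl in H. lra.
Qed.

Definition Lg (t : R) : R := ln ((1 + t) / t).

Lemma Lg_ratio_gt_1 (t : R) : 0 < t -> 1 < (1 + t) / t.
Proof.
  intros ht. apply Rmult_lt_reg_r with t. assumption. unfold Rdiv.
  rewrite Rmult_assoc, Rinv_l; lra.
Qed.

Lemma is_derive_Lg (t : R) : 0 < t -> is_derive Lg t (/ (1 + t) - / t).
Proof.
  intros ht. assert (h := Lg_ratio_gt_1 t ht). unfold Lg. auto_derive.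
  - repeat split. lra. lra.
  - field. repeat split; lra.
Qed.

Lemma ln_le_sub_1 (y : R) : 0 < y -> ln y <= y - 1.
Proof.
  intros hy. assert (H := exp_ineq1_le (ln y)). rewrite exp_ln in H; lra.
Qed.

Lemma Lg_pos (t : R) : 0 < t -> 0 < Lg t.
Proof.
  intros ht. unfold Lg. rewrite <- ln_1. apply ln_increasing. lra.
  now apply Lg_ratio_gt_1.
Qed.

Lemma Lg_le_inv (t : R) : 0 < t -> Lg t <= / t.
Proof.
  intros ht. assert (h := Lg_ratio_gt_1 t ht).
  apply Rle_trans with ((1 + t) / t - 1). apply ln_le_sub_1. lra.
  apply Req_le. field. lra.
Qed.

(* [ln y = 2 ln (sqrt y) <= 2 sqrt y]; the bound is continuous and vanishes at [0]. *)
Lemma mul_Lg_le_sqrt (t : R) : 0 < t -> t * Lg t <= 2 * sqrt (t * t + t).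
Proof.
  intros ht. assert (h := Lg_ratio_gt_1 t ht).
  assert (hs : 0 < sqrt ((1 + t) / t)) by (apply sqrt_lt_R0; lra).
  assert (H : Lg t <= 2 * sqrt ((1 + t) / t)).
  { unfold Lg. rewrite <- (sqrt_sqrt ((1 + t) / t)) at 1 by lra.
    rewrite ln_mult by assumption.
    assert (H := ln_le_sub_1 _ hs). lra. }
  replace (t * t + t) with ((t * t) * ((1 + t) / t)) by (field; lra).
  rewrite sqrt_mult, sqrt_square by nra.
  replace (2 * (t * sqrt ((1 + t) / t))) with (t * (2 * sqrt ((1 + t) / t))) by ring.
  apply Rmult_le_compat_l; lra.
Qed.

Lemma is_lim_Lg : is_lim Lg p_infty 0.
Proof.
  apply is_lim_le_le_loc with (fun _ => 0) (fun t => / t).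
  - exists 0. intros t ht. split. now apply Rlt_le, Lg_pos. now apply Lg_le_inv.
  - apply is_lim_const.
  - apply is_lim_inv with (1 := is_lim_id p_infty). easy.
Qed.

(** A factor of order [t] beats the logarithmic singularity: the product is squeezed below [c t]
    times the bound of [mul_Lg_le_sqrt]. *)
Lemma filterlim_Lg_at_right0 (g : R -> R) (c : R -> R) :
  continuous c 0 ->
  (forall t, 0 < t -> 0 <= g t <= c t * t) ->
  filterlim (fun t => g t * Lg t) (at_right 0) (locally 0).
Proof.
  intros Hc Hg.
  set (b := fun t => c t * (2 * sqrt (t * t + t))).
  assert (Hb : continuous b 0).
  { apply (continuous_mult c). assumption.
    apply (continuous_mult (fun _ => 2)). apply continuous_const.
    apply continuous_comp with (g := sqrt).
    - continuous_by_derive. easy.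
    - apply continuous_sqrt. }
  assert (Hb0 : b 0 = 0).
  { unfold b. replace (0 * 0 + 0) with 0 by ring. rewrite sqrt_0. ring. }
  apply continuous_at_right in Hb. rewrite Hb0 in Hb.
  apply (filterlim_le_le (F := at_right 0) (fun _ => 0) (fun t => g t * Lg t) b 0).
  - apply filter_imp with (2 := at_right0_pos). intros t ht.
    destruct (Hg t ht) as [h0 h1]. assert (hL := Lg_pos t ht). split.
    + apply Rmult_le_pos; lra.
    + apply Rle_trans with (c t * t * Lg t). apply Rmult_le_compat_r; lra.
      unfold b. rewrite Rmult_assoc. apply Rmult_le_compat_l.
      * apply Rmult_le_reg_r with t; lra.
      * now apply mul_Lg_le_sqrt.
  - apply filterlim_const.
  - exact Hb.
Qed.

Lemma is_lim_comp_pinfty (f g : R -> R) (l : R) :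
  is_lim f p_infty l -> is_lim g p_infty p_infty -> is_lim (fun t => f (g t)) p_infty l.
Proof. intros Hf Hg. now apply filterlim_comp with (2 := Hf). Qed.

Lemma is_lim_affine (x c : R) : 0 < x -> is_lim (fun t => x * (c + t)) p_infty p_infty.
Proof.
  intros hx. apply is_lim_spec. intros M. exists (M / x - c). intros t ht.
  assert (H : M = x * (M / x)) by (field; lra). rewrite H.
  apply Rmult_lt_compat_l; lra.
Qed.

(** For [m = 0] substitute [u = x (1 + t)]. The step uses [t^(m+1)/(1+t) = t^m - t^m/(1+t)]: the
    first piece is the Euler integral, and the difference matches the recurrence of
    [Gamma(-m, x)]. *)
Lemma is_RInt_gen_pow_exp_div (x : R) (m : nat) :
  0 < x ->
  is_RInt_gen (fun t => exp (- x * t) * t ^ m / (1 + t))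
    (at_right 0) (Rbar_locally p_infty)
    (INR (fact m) * exp x * upper_gamma (- Z.of_nat m) x).
Proof.
  intros hx. induction m as [|m IH].
  - set (F := fun t => exp x * E1_partial x (x * (1 + t))).
    (* The range [t > -1] includes 0, so differentiability also gives the limit of [F] at the left
       endpoint. *)
    assert (HD : forall t, -1 < t -> is_derive F t (exp (- x * t) * t ^ 0 / (1 + t))).
    { intros t ht.
      assert (h : 0 < x * (1 + t)) by (apply Rmult_lt_0_compat; lra).
      assert (H := is_derive_E1_partial x _ hx h).
      unfold F. auto_derive. eexists; apply H.
      rewrite (is_derive_unique (fun x0 : R => E1_partial x x0) _ _ H).
      replace (- x * t) with (x + - (x * (1 + t))) by ring.
      rewrite exp_plus. simpl. field. lra. }
    replace (INR (fact 0) * exp x * upper_gamma (- Z.of_nat 0) x)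
      with (exp x * upper_gamma 0 x - F 0).
    2: { unfold F. replace (x * (1 + 0)) with x by ring.
         unfold E1_partial. rewrite RInt_point. unfold zero; simpl. ring. }
    apply is_RInt_gen_half_line with F.
    + intros t ht. apply HD. lra.
    + intros t ht. continuous_by_derive. lra.
    + apply continuous_at_right.
      apply (ex_derive_continuous (K := R_AbsRing) (V := R_NormedModule)).
      eexists. apply HD. lra.
    + apply (is_lim_scal_l (fun t => E1_partial x (x * (1 + t))) (exp x) p_infty (upper_gamma 0 x)).
      apply (is_lim_comp_pinfty (E1_partial x) (fun t => x * (1 + t))).
      now apply is_lim_E1_partial. now apply is_lim_affine.
  - assert (H := is_RInt_gen_minus _ _ _ _ (is_RInt_gen_pow_exp x m hx) IH).
    unfold minus, plus, opp in H; simpl in H.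
    rewrite upper_gamma_succ by assumption.
    replace (INR (fact (S m)) * exp x *
      ((exp (- x) / x ^ S m - upper_gamma (- Z.of_nat m) x) / INR (S m)))
      with (INR (fact m) / (x * x ^ m)
        + - (INR (fact m) * exp x * upper_gamma (- Z.of_nat m) x)).
    2: { rewrite fact_simpl, mult_INR, exp_Ropp. simpl (x ^ S m).
         assert (0 < x ^ m) by now apply pow_lt. assert (h := exp_pos x).
         field. repeat split; try lra. apply not_0_INR. lia. }
    apply is_RInt_gen_half_line_ext with (2 := H).
    intros t ht. simpl. field. lra.
Qed.

(** * The lower incomplete gamma function *)

Lemma is_RInt_gen_sum_n (Fa Fb : (R -> Prop) -> Prop)
    {FFa : Filter Fa} {FFb : Filter Fb} (f : nat -> R -> R) (l : nat -> R) (n : nat) :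
  (forall k, is_RInt_gen (f k) Fa Fb (l k)) ->
  is_RInt_gen (fun t => sum_n (fun k => f k t) n) Fa Fb (sum_n l n).
Proof.
  intros H. induction n as [|n IH].
  - rewrite sum_O. apply is_RInt_gen_ext with (2 := H 0%nat).
    apply filter_forall. intros ab t _. now rewrite sum_O.
  - rewrite sum_Sn.
    apply is_RInt_gen_ext with (2 := is_RInt_gen_plus _ _ _ _ IH (H (S n))).
    apply filter_forall. intros ab t _. now rewrite sum_Sn.
Qed.

Lemma sum_n_Rmult_l (a : R) (u : nat -> R) (n : nat) :
  sum_n (fun k => a * u k) n = a * sum_n u n.
Proof. apply (sum_n_mult_l (K := R_Ring)). Qed.

Lemma sum_n_Rmult_r (a : R) (u : nat -> R) (n : nat) :
  sum_n (fun k => u k * a) n = sum_n u n * a.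
Proof. apply (sum_n_mult_r (K := R_Ring)). Qed.

Lemma sum_n_Rplus (u v : nat -> R) (n : nat) :
  sum_n (fun k => u k + v k) n = sum_n u n + sum_n v n.
Proof. apply (sum_n_plus (G := R_AbelianMonoid)). Qed.

Lemma lower_gamma_nat (m : nat) (z : R) :
  is_RInt (fun t => t ^ m * exp (- t)) 0 z (lower_gamma (Z.of_nat (S m)) z).
Proof.
  unfold lower_gamma.
  apply is_RInt_ext with (fun t => powerRZ t (Z.of_nat (S m) - 1) * exp (- t)).
  { intros t _. replace (Z.of_nat (S m) - 1)%Z with (Z.of_nat m) by lia.
    now rewrite <- pow_powerRZ. }
  apply (RInt_correct (V := R_CompleteNormedModule)).
  apply ex_RInt_ext with (fun t => t ^ m * exp (- t)).
  { intros t _. replace (Z.of_nat (S m) - 1)%Z with (Z.of_nat m) by lia.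
    now rewrite <- pow_powerRZ. }
  apply (ex_RInt_continuous (V := R_CompleteNormedModule)).
  intros t _. continuous_by_derive. easy.
Qed.

Lemma is_RInt_eq (f g : R -> R) (a b lf lg : R) :
  is_RInt f a b lf -> is_RInt g a b lg -> (forall t, f t = g t) -> lf = lg.
Proof.
  intros Hf Hg H.
  rewrite <- (is_RInt_unique (V := R_CompleteNormedModule) _ _ _ _ Hf).
  rewrite <- (is_RInt_unique (V := R_CompleteNormedModule) _ _ _ _ Hg).
  apply RInt_ext. intros t _. apply H.
Qed.

Lemma lower_gamma_1 (z : R) : lower_gamma 1 z = 1 - exp (- z).
Proof.
  apply (is_RInt_eq (fun t => t ^ 0 * exp (- t)) (fun t => exp (- t)) 0 z).
  - apply (lower_gamma_nat 0).
  - replace (1 - exp (- z)) with (minus (- exp (- z)) (- exp (- 0))).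
    2: { rewrite Ropp_0, exp_0. unfold minus, plus, opp; simpl. ring. }
    apply (is_RInt_derive (V := R_CompleteNormedModule) (fun t => - exp (- t))).
    + intros t _. auto_derive. easy. ring.
    + intros t _. continuous_by_derive. easy.
  - intros t. simpl. ring.
Qed.

(** Integrate the derivative of [t ^ S m * exp (- t)], whose value at 0 vanishes; the sign of [z]
    does not matter, and [z = - x] is used later. *)
Lemma lower_gamma_succ (m : nat) (z : R) :
  lower_gamma (Z.of_nat (S (S m))) z
  = INR (S m) * lower_gamma (Z.of_nat (S m)) z - z ^ S m * exp (- z).
Proof.
  assert (H : is_RInt (fun t => INR (S m) * (t ^ m * exp (- t)) - t ^ S m * exp (- t)) 0 z
      (minus (z ^ S m * exp (- z)) (0 ^ S m * exp (- 0)))).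
  { apply (is_RInt_derive (V := R_CompleteNormedModule) (fun t => t ^ S m * exp (- t))).
    - intros t _. auto_derive. easy. refold_INR. rewrite S_INR. simpl. ring.
    - intros t _. continuous_by_derive. easy. }
  assert (H1 := is_RInt_minus _ _ _ _ _ _
    (is_RInt_scal _ _ _ (INR (S m)) _ (lower_gamma_nat m z)) (lower_gamma_nat (S m) z)).
  assert (H2 := is_RInt_eq _ _ _ _ _ _ H1 H (fun t => eq_refl)).
  rewrite pow_i in H2 by lia.
  change (INR (S m) * lower_gamma (Z.of_nat (S m)) z + - lower_gamma (Z.of_nat (S (S m))) z
    = z ^ S m * exp (- z) + - (0 * exp (- 0))) in H2. lra.
Qed.

(* Substitute [t = u - x] and expand [(u - x)^m]. *)
Lemma lower_gamma_opp (m : nat) (x : R) :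
  lower_gamma (Z.of_nat (S m)) (- x)
  = - exp x * sum_n (fun j => Binomial.C m j * (- x) ^ (m - j)
                              * lower_gamma (Z.of_nat (S j)) x) m.
Proof.
  set (s := sum_n _ m).
  assert (H1 : is_RInt (fun t => sum_n (fun j => Binomial.C m j * (- x) ^ (m - j)
                   * (t ^ j * exp (- t))) m) 0 x s).
  { apply is_RInt_gen_at_point. apply (is_RInt_gen_sum_n _ _). intros k.
    apply is_RInt_gen_at_point.
    apply (is_RInt_scal (V := R_NormedModule)). apply lower_gamma_nat. }
  assert (H2 : is_RInt (fun t => scal 1 ((1 * t + - x) ^ m * exp (- (1 * t + - x)))) x 0
      (lower_gamma (Z.of_nat (S m)) (- x))).
  { apply (is_RInt_comp_lin (fun t => t ^ m * exp (- t))).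
    replace (1 * x + - x) with 0 by ring. replace (1 * 0 + - x) with (- x) by ring.
    apply lower_gamma_nat. }
  apply is_RInt_swap in H2.
  apply (is_RInt_scal _ _ _ (exp x)) in H1.
  apply Ropp_eq_reg. replace (- (- exp x * s)) with (exp x * s) by ring.
  apply (is_RInt_eq _ _ _ _ _ _ H2 H1). intros t.
  unfold scal; simpl; unfold mult; simpl.
  replace (1 * t + - x) with (t + - x) by ring.
  rewrite binomial, <- sum_n_Reals.
  replace (- (t + - x)) with (x + - t) by ring. rewrite exp_plus, Rmult_1_l.
  rewrite <- sum_n_Rmult_r, <- sum_n_Rmult_l.
  apply sum_n_ext. intros j. eq_in_R. ring.
Qed.

Definition gamma_sum (m : nat) (x : R) : R :=
  sum_n_m (fun l => Binomial.C m l * powerRZ (- x) (- Z.of_nat l)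
                    * lower_gamma (Z.of_nat l) x) 1 m.

Lemma C_diag (m : nat) : Binomial.C m m = 1.
Proof.
  unfold Binomial.C. rewrite Nat.sub_diag. simpl. field. apply INR_fact_neq_0.
Qed.

(** Pascal's rule splits [C(m+1, j+1)] into [C(m, j+1)], which rebuilds [gamma_sum m], and
    [C(m, j)], whose sum is [gamma(m+1, -x)] up to a factor by [lower_gamma_opp]. *)
Lemma gamma_sum_succ (m : nat) (x : R) :
  0 < x ->
  gamma_sum (S m) x
  = gamma_sum m x - lower_gamma (Z.of_nat (S m)) (- x) * exp (- x) / (- x) ^ S m.
Proof.
  intros hx. unfold gamma_sum. rewrite <- sum_n_m_S.
  set (b := fun j => powerRZ (- x) (- Z.of_nat (S j)) * lower_gamma (Z.of_nat (S j)) x).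
  assert (Hb : - (lower_gamma (Z.of_nat (S m)) (- x) * exp (- x) / (- x) ^ S m)
    = sum_n (fun j => Binomial.C m j * b j) m).
  { rewrite lower_gamma_opp, exp_Ropp.
    assert (he := exp_pos x). assert (hp : forall k, (- x) ^ k <> 0).
    { intros k. apply pow_nonzero. lra. }
    set (s := sum_n _ m).
    replace (- (- exp x * s * / exp x / (- x) ^ S m)) with (/ (- x) ^ S m * s).
    2: { field. split; (apply hp || lra). }
    unfold s. rewrite <- sum_n_Rmult_l. apply sum_n_ext_loc.
    intros j hj. unfold b, mult; simpl mult. rewrite powerRZ_opp_nat.
    replace (S m) with (m - j + S j)%nat by lia. rewrite pow_add.
    assert (h1 := hp (m - j)%nat). assert (h2 := hp (S j)). eq_in_R. field. now split. }
  unfold Rminus at 1. rewrite Hb.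
  rewrite (sum_n_m_ext _ (fun j => Binomial.C (S m) (S j) * b j)).
  2: { intros j. unfold b. eq_in_R. ring. }
  change (sum_n (fun j => Binomial.C (S m) (S j) * b j) m =
    sum_n_m (fun l => Binomial.C m l * powerRZ (- x) (- Z.of_nat l)
                    * lower_gamma (Z.of_nat l) x) 1 m + sum_n (fun j => Binomial.C m j * b j) m).
  (* For [m = 0] the sum from 1 to [m] is empty and its index cannot be shifted down. *)
  destruct m as [|m].
  - rewrite sum_n_m_zero by lia. rewrite !sum_O, !C_diag. unfold zero; simpl. eq_in_R. ring.
  - rewrite <- sum_n_m_S.
    rewrite (sum_n_m_ext (fun n => _ * lower_gamma _ _) (fun j => Binomial.C (S m) (S j) * b j)).
    2: { intros j. unfold b. eq_in_R. ring. }
    change (sum_n_m ?f 0 m) with (sum_n f m).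
    rewrite !sum_Sn, !C_diag.
    (* The top term has coefficient 1 on both sides and has been split off; Pascal's rule holds in
       the remaining range [j <= m]. *)
    rewrite (sum_n_ext_loc (fun j => Binomial.C (S (S m)) (S j) * b j)
      (fun j => plus (Binomial.C (S m) (S j) * b j) (Binomial.C (S m) j * b j))).
    2: { intros j hj. rewrite <- pascal by lia. unfold plus; simpl. eq_in_R. ring. }
    rewrite sum_n_plus. unfold plus; simpl. eq_in_R. ring.
Qed.

(** * Logarithmic moments *)

(** The closed form of [J_m]. The multiples of [Ein x] are collected into the Bessel term only at
    the very end. *)
Definition log_moment (m : nat) (x : R) : R :=
  INR (fact m) / x ^ S m
  * (Ein x + (-1) ^ S m * upper_gamma (- Z.of_nat m) x
               * lower_gamma (Z.of_nat (S m)) (- x)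
     - harmonic m - gamma_sum m x).

Lemma harmonic_succ (m : nat) : harmonic (S m) = harmonic m + / INR (S m).
Proof. unfold harmonic. rewrite sum_n_Sm by lia. reflexivity. Qed.

Lemma log_moment_0 (x : R) :
  0 < x ->
  log_moment 0 x = / x * (Ein x - upper_gamma 0 x + exp x * upper_gamma 0 x).
Proof.
  intros hx. unfold log_moment, harmonic, gamma_sum.
  rewrite !sum_n_m_zero by lia. change (lower_gamma (Z.of_nat 1)) with (lower_gamma 1).
  rewrite lower_gamma_1, Ropp_involutive. unfold zero; simpl. field. lra.
Qed.

(** In the product of the two gamma recurrences, the boundary terms multiply to [1/(m+1)] and cancel
    the harmonic increment, while the boundary term of [Gamma(-m-1, x)] times [gamma(m+1, -x)]
    cancels the increment of [gamma_sum]. The remaining cross term is the subtracted one. *)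
Lemma log_moment_succ (m : nat) (x : R) :
  0 < x ->
  log_moment (S m) x
  = / x * (INR (S m) * log_moment m x
           - INR (fact m) * exp x * upper_gamma (- Z.of_nat m) x).
Proof.
  intros hx. unfold log_moment.
  rewrite gamma_sum_succ, harmonic_succ, upper_gamma_succ, lower_gamma_succ by assumption.
  replace (- x) with (-1 * x) by ring. rewrite Rpow_mult_distr.
  replace (-1 * x) with (- x) by ring.
  rewrite Ropp_involutive, exp_Ropp, fact_simpl, mult_INR.
  assert (hE := exp_pos x). assert (hX : 0 < x ^ m) by now apply pow_lt.
  assert (hm := lt_0_INR (S m) ltac:(lia)).
  set (N := INR (S m)) in *. set (g := lower_gamma _ (- x)).
  set (G := upper_gamma _ x). rewrite <- !tech_pow_Rmult.
  (* Products of two powers of -1 occur; once the sign is fixed, the identity is rational. *)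
  assert (hs : (-1) ^ m = 1 \/ (-1) ^ m = -1).
  { clear. induction m as [|m [IH|IH]]; simpl; [left|right|left]; lra. }
  destruct hs as [-> | ->]; field; repeat split; lra.
Qed.

Lemma exp_opp_mul_lt_1 (x t : R) : 0 < x -> 0 < t -> exp (- x * t) < 1.
Proof.
  intros hx ht. rewrite <- exp_0. apply exp_increasing.
  assert (0 < x * t) by now apply Rmult_lt_0_compat. lra.
Qed.

Lemma is_RInt_gen_log_moment (x : R) (m : nat) :
  0 < x ->
  is_RInt_gen (fun t => exp (- x * t) * t ^ m * Lg t)
    (at_right 0) (Rbar_locally p_infty) (log_moment m x).
Proof.
  intros hx. induction m as [|m IH].
  (* The antiderivative is split so that [u] carries the logarithmic singularity, whereas [v] is
     differentiable at 0 and vanishes there. *)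
  - set (u := fun t => (1 - exp (- x * t)) * Lg t).
    set (v := fun t => Ein (x * t) - ln (1 + t) + exp x * E1_partial x (x * (1 + t))).
    set (F := fun t => / x * (u t + v t)).
    assert (Hdv : forall t, 0 <= t -> is_derive v t
      (x * Ein_integrand (x * t) - (1 - exp (- x * t)) / (1 + t))).
    { intros t ht. assert (h : 0 < x * (1 + t)) by (apply Rmult_lt_0_compat; lra).
      assert (H1 := is_derive_E1_partial x _ hx h).
      assert (H2 := is_derive_Ein (x * t)).
      unfold v. auto_derive.
      { repeat split. eexists; apply H2. lra. eexists; apply H1. }
      rewrite (is_derive_unique (fun x0 : R => E1_partial x x0) _ _ H1).
      rewrite (is_derive_unique (fun x0 : R => Ein x0) _ _ H2).
      replace (- x * t) with (x + - (x * (1 + t))) by ring.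
      rewrite exp_plus. simpl. field. lra. }
    rewrite log_moment_0 by assumption.
    set (l := / x * _). rewrite <- (Rminus_0_r l).
    apply is_RInt_gen_half_line with F.
    + intros t ht. assert (H0 := is_derive_Lg t ht).
      assert (H1 := Hdv t (Rlt_le _ _ ht)).
      unfold F, u. auto_derive.
      { repeat split; eexists; eassumption. }
      rewrite (is_derive_unique (fun x0 : R => Lg x0) _ _ H0).
      rewrite (is_derive_unique (fun x0 : R => v x0) _ _ H1).
      rewrite Ein_integrand_pos by now apply Rmult_lt_0_compat.
      replace (- (x * t)) with (- x * t) by ring. simpl. field. lra.
    + intros t ht. continuous_by_derive. eexists. now apply is_derive_Lg.
    + replace 0 with (/ x * (0 + v 0)) at 2.
      2: { unfold v. replace (x * (1 + 0)) with x by ring. unfold E1_partial.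
           rewrite RInt_point, Rmult_0_r, Ein_0, Rplus_0_r, ln_1.
           unfold zero; simpl. ring. }
      apply (filterlim_comp _ _ _ (fun t => u t + v t) (fun y => / x * y) _
               (locally (0 + v 0))).
      2: { apply (continuous_mult (fun _ => / x) (fun y => y)).
           apply continuous_const. apply continuous_id. }
      apply (filterlim_comp_2 (F := at_right 0) (G := locally 0) (H := locally (v 0))
        u v Rplus).
      (* The factor of order [t] is [1 - exp (- x t) <= x t]. *)
      * apply (filterlim_Lg_at_right0 _ (fun _ => x)). apply continuous_const.
        intros t ht. assert (H := exp_ineq1_le (- x * t)).
        assert (H' := exp_opp_mul_lt_1 x t hx ht).
        lra.
      * apply continuous_at_right.
        apply (ex_derive_continuous (K := R_AbsRing) (V := R_NormedModule)).
        eexists. apply Hdv. lra.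
      * apply (filterlim_plus (K := R_AbsRing) (V := R_NormedModule) 0 (v 0)).
    (* For [t > 1], [Ein (x t)] equals [Ein x + ln t] minus a convergent integral, and its [ln t]
       cancels against [Lg t - ln (1 + t)]. The form [0 + t] matches [is_lim_affine]. *)
    + apply is_lim_ext_loc with (fun t => / x * (Ein x - exp (- x * t) * Lg t
        - E1_partial x (x * (0 + t)) + exp x * E1_partial x (x * (1 + t)))).
      { exists 1. intros t ht. unfold F, u, v.
        rewrite (Ein_E1_partial x (x * t)).
        2: { split. assumption. rewrite <- (Rmult_1_r x) at 1.
             apply Rmult_le_compat_l; lra. }
        rewrite ln_mult by lra. unfold Lg, Rdiv. rewrite ln_mult, ln_Rinv.
        2: lra. 2: lra. 2: { apply Rinv_0_lt_compat. lra. }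
        replace (0 + t) with t by ring. ring. }
      unfold l. apply (is_lim_scal_l _ _ _ (Finite _)).
      apply is_lim_plus'.
      * replace (Ein x - upper_gamma 0 x) with (Ein x - 0 - upper_gamma 0 x) by ring.
        apply is_lim_minus'. apply is_lim_minus'. apply is_lim_const.
        -- apply is_lim_le_le_loc with (fun _ => 0) Lg.
           ++ exists 0. intros t ht. assert (hL := Lg_pos t ht).
              assert (he := exp_pos (- x * t)).
              assert (H' := exp_opp_mul_lt_1 x t hx ht).
              split; nra.
           ++ apply is_lim_const.
           ++ apply is_lim_Lg.
        -- apply (is_lim_comp_pinfty (E1_partial x) (fun t => x * (0 + t))).
           now apply is_lim_E1_partial. now apply is_lim_affine.
      * apply (is_lim_scal_l (fun t => E1_partial x (x * (1 + t))) (exp x) p_infty (upper_gamma 0 x)).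
        apply (is_lim_comp_pinfty (E1_partial x) (fun t => x * (1 + t))).
        now apply is_lim_E1_partial. now apply is_lim_affine.
  - set (F := fun t => t ^ S m * exp (- x * t) * Lg t).
    assert (HF : is_RInt_gen (fun t => INR (S m) * (exp (- x * t) * t ^ m * Lg t)
        - x * (exp (- x * t) * t ^ S m * Lg t) - exp (- x * t) * t ^ m / (1 + t))
        (at_right 0) (Rbar_locally p_infty) (0 - 0)).
    { apply is_RInt_gen_half_line with F.
      - intros t ht. assert (H0 := is_derive_Lg t ht). unfold F. auto_derive.
        { eexists; eassumption. }
        rewrite (is_derive_unique (fun x0 : R => Lg x0) _ _ H0).
        refold_INR. rewrite S_INR. simpl. field. lra.
      - intros t ht. continuous_by_derive.
        repeat split; try (eexists; now apply is_derive_Lg). lra.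
      - apply (filterlim_Lg_at_right0 _ (fun t => t ^ m)).
        continuous_by_derive. easy.
        intros t ht. assert (h : 0 < t ^ m) by now apply pow_lt.
        assert (he := exp_pos (- x * t)).
        assert (H' := exp_opp_mul_lt_1 x t hx ht).
        assert (h2 : 0 < t ^ m * t) by now apply Rmult_lt_0_compat.
        simpl. nra.
      - apply is_lim_le_le_loc with (fun _ => 0) (fun t => t ^ m * exp (- x * t)).
        + exists 0. intros t ht. assert (h : 0 < t ^ m) by now apply pow_lt.
          assert (he := exp_pos (- x * t)). assert (hL := Lg_pos t ht).
          assert (hL' := Lg_le_inv t ht).
          (* One factor [t] absorbs [Lg t], leaving [t ^ m * exp (- x t)] as the bound. *)
          assert (h1 : t * Lg t <= 1).
          { apply Rmult_le_reg_l with (/ t). now apply Rinv_0_lt_compat.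
            rewrite <- Rmult_assoc, Rinv_l; lra. }
          assert (h2 : 0 < t ^ m * exp (- x * t)) by now apply Rmult_lt_0_compat.
          unfold F. simpl.
          replace (t * t ^ m * exp (- x * t) * Lg t)
            with (t ^ m * exp (- x * t) * (t * Lg t)) by ring.
          split. apply Rmult_le_pos; nra. nra.
        + apply is_lim_const.
        + now apply is_lim_pow_exp. }
    (* Solving the integrand of [HF] for the term with [t ^ S m] yields the convergence of the next
       moment together with its value. *)
    assert (H := is_RInt_gen_scal _ (/ x) _ (is_RInt_gen_minus _ _ _ _
      (is_RInt_gen_minus _ _ _ _ (is_RInt_gen_scal _ (INR (S m)) _ IH)
        (is_RInt_gen_pow_exp_div x m hx)) HF)).
    unfold scal, minus, plus, opp in H. simpl in H. unfold mult in H. simpl in H.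
    rewrite log_moment_succ by assumption.
    set (l := / x * _).
    replace l with (/ x * (INR (S m) * log_moment m x
      + - (INR (fact m) * exp x * upper_gamma (- Z.of_nat m) x) + - (0 - 0)))
      by (unfold l; ring).
    apply is_RInt_gen_half_line_ext with (2 := H).
    intros t ht. simpl. field. lra.
Qed.

(** * The Gamma function at half-integers *)

Definition gauss (y : R) : R := RInt (fun s => exp (- (s * s))) 0 y.

(** Its integral over [s] in [[0, 1]] complements the square of [gauss y] to a constant; this
    evaluates the Gaussian integral without a double integral. *)
Definition gauss_kernel (y s : R) : R := exp (- (y * y * (1 + s * s))) / (1 + s * s).

Lemma continuous_gauss (s : R) : continuous (fun s => exp (- (s * s))) s.
Proof. continuous_by_derive. easy. Qed.

Lemma is_derive_gauss (y : R) : is_derive gauss y (exp (- (y * y))).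
Proof.
  apply (is_derive_RInt (fun s => exp (- (s * s))) gauss 0).
  - apply filter_forall. intros b. apply (RInt_correct (V := R_CompleteNormedModule)).
    apply (ex_RInt_continuous (V := R_CompleteNormedModule)).
    intros t _. apply continuous_gauss.
  - apply continuous_gauss.
Qed.

Lemma is_derive_gauss_kernel (y s : R) :
  is_derive (fun y => gauss_kernel y s) y (- (2 * y) * exp (- (y * y * (1 + s * s)))).
Proof.
  unfold gauss_kernel. auto_derive. easy. field. nra.
Qed.

Lemma ex_RInt_gauss_kernel (y : R) : ex_RInt (gauss_kernel y) 0 1.
Proof.
  apply (ex_RInt_continuous (V := R_CompleteNormedModule)). intros s _.
  unfold gauss_kernel. continuous_by_derive. nra.
Qed.

(** Under the integral sign the derivative cancels the denominator [1 + s^2]; the substitution of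
    [y s] for the variable then produces [gauss y]. *)
Lemma is_derive_RInt_gauss_kernel (y : R) :
  is_derive (fun y => RInt (gauss_kernel y) 0 1) y (- 2 * exp (- (y * y)) * gauss y).
Proof.
  replace (- 2 * exp (- (y * y)) * gauss y)
    with (RInt (fun s => Derive (fun y => gauss_kernel y s) y) 0 1).
  - apply is_derive_RInt_param.
    + apply filter_forall. intros z s _. eexists. apply is_derive_gauss_kernel.
    + intros s _. apply continuity_2d_pt_ext with
        (fun u v => (- (2 * u)) * exp (- (u * u * (1 + v * v)))).
      { intros u v. symmetry. apply is_derive_unique, is_derive_gauss_kernel. }
      repeat (apply continuity_2d_pt_mult || apply continuity_2d_pt_plus
        || apply continuity_2d_pt_opp || apply continuity_2d_pt_id1
        || apply continuity_2d_pt_id2 || apply continuity_2d_pt_const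
        || apply continuity_1d_2d_pt_comp).
      apply derivable_continuous_pt, derivable_pt_exp.
    + apply filter_forall. intros z. apply ex_RInt_gauss_kernel.
  - set (c := - 2 * exp (- (y * y))).
    assert (H1 : is_RInt (fun s => c * (y * exp (- ((y * s + 0) * (y * s + 0))))) 0 1
                   (c * gauss y)).
    { apply (is_RInt_scal (V := R_NormedModule)).
      apply (is_RInt_comp_lin (fun s => exp (- (s * s)))).
      rewrite Rmult_0_r, Rmult_1_r, !Rplus_0_r.
      apply (RInt_correct (V := R_CompleteNormedModule)).
      apply (ex_RInt_continuous (V := R_CompleteNormedModule)).
      intros s _. apply continuous_gauss. }
    rewrite <- (is_RInt_unique (V := R_CompleteNormedModule) _ _ _ _ H1).
    apply RInt_ext. intros s _.
    apply (eq_trans (is_derive_unique _ _ _ (is_derive_gauss_kernel y s))).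
    replace (- (y * y * (1 + s * s)))
      with (- (y * y) + - ((y * s + 0) * (y * s + 0))) by ring.
    rewrite exp_plus. unfold c. eq_in_R. ring.
Qed.

Lemma gauss_kernel_0 : RInt (gauss_kernel 0) 0 1 = PI / 4.
Proof.
  replace (PI / 4) with (minus (atan 1) (atan 0)).
  2: { rewrite atan_1, atan_0. unfold minus, plus, opp; simpl. ring. }
  apply (is_RInt_unique (V := R_CompleteNormedModule)).
  apply is_RInt_ext with (fun s => / (1 + s ^ 2)).
  { intros s _. unfold gauss_kernel. rewrite !Rmult_0_l, Ropp_0, exp_0. simpl.
    eq_in_R. field. nra. }
  apply (is_RInt_derive (V := R_CompleteNormedModule) atan).
  - intros s _. apply is_derive_Reals.
    apply derivable_pt_lim_atan.
  - intros s _. continuous_by_derive. nra.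
Qed.

(* The derivatives of the two summands cancel, and at [y = 0] the sum is [atan 1]. *)
Lemma gauss_identity (y : R) :
  0 <= y -> gauss y * gauss y + RInt (gauss_kernel y) 0 1 = PI / 4.
Proof.
  intros [hy | <-].
  2: { unfold gauss. rewrite RInt_point, gauss_kernel_0. unfold zero; simpl. ring. }
  rewrite <- gauss_kernel_0.
  replace (RInt (gauss_kernel 0) 0 1)
    with (gauss 0 * gauss 0 + RInt (gauss_kernel 0) 0 1).
  2: { unfold gauss. rewrite RInt_point. unfold zero; simpl. ring. }
  symmetry. apply (eq_is_derive (fun y => gauss y * gauss y + RInt (gauss_kernel y) 0 1));
    [|assumption].
  intros t _.
  replace (@zero R_NormedModule)
    with ((exp (- (t * t)) * gauss t + gauss t * exp (- (t * t)))
          + - 2 * exp (- (t * t)) * gauss t).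
  2: { unfold zero; simpl. eq_in_R. ring. }
  apply (is_derive_plus (fun y => gauss y * gauss y)).
  - apply (is_derive_mult gauss gauss); try apply is_derive_gauss.
    intros a b. apply Rmult_comm.
  - apply is_derive_RInt_gauss_kernel.
Qed.

(** By [gauss_identity] and positivity, [gauss y] is the square root of [PI / 4] minus the kernel
    integral, and that integral is at most [exp (- y)] for [y > 1]. *)
Lemma is_lim_gauss : is_lim gauss p_infty (sqrt PI / 2).
Proof.
  apply is_lim_ext_loc with (fun y => sqrt (PI / 4 - RInt (gauss_kernel y) 0 1)).
  { exists 0. intros y hy. rewrite <- (gauss_identity y) by lra.
    replace (_ + _ - _) with (gauss y * gauss y) by ring.
    apply sqrt_square. apply RInt_ge_0. lra.
    apply (ex_RInt_continuous (V := R_CompleteNormedModule)).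
    intros s _. apply continuous_gauss.
    intros s _. apply Rlt_le, exp_pos. }
  replace (sqrt PI / 2) with (sqrt (PI / 4 - 0)).
  2: { rewrite Rminus_0_r. replace (PI / 4) with (PI * (/ 2 * / 2)) by field.
       assert (h := PI_RGT_0). rewrite sqrt_mult, sqrt_square by lra. reflexivity. }
  apply (is_lim_comp_continuous (fun y => PI / 4 - RInt (gauss_kernel y) 0 1) sqrt).
  2: apply continuous_sqrt.
  apply is_lim_minus'. apply is_lim_const.
  apply is_lim_le_le_loc with (fun _ => 0) (fun y => exp (- 1 * y)).
  - exists 1. intros y hy. split.
    + apply RInt_ge_0. lra. apply ex_RInt_gauss_kernel.
      intros s _. apply Rlt_le, Rdiv_lt_0_compat. apply exp_pos. nra.
    + replace (exp (- 1 * y)) with (RInt (fun _ => exp (- 1 * y)) 0 1).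
      2: { rewrite RInt_const. unfold scal; simpl; unfold mult; simpl. eq_in_R. ring. }
      apply RInt_le. lra. apply ex_RInt_gauss_kernel. apply ex_RInt_const.
      intros s _. unfold gauss_kernel.
      assert (H : exp (- (y * y * (1 + s * s))) <= exp (- 1 * y)).
      { destruct (Rle_lt_or_eq_dec (- (y * y * (1 + s * s))) (- 1 * y)) as [h|h].
        - assert (0 <= y * y * (s * s)) by nra. nra.
        - now apply Rlt_le, exp_increasing.
        - rewrite h. apply Rle_refl. }
      assert (he := exp_pos (- (y * y * (1 + s * s)))).
      apply Rle_trans with (2 := H).
      apply Rmult_le_reg_r with (1 + s * s). nra.
      unfold Rdiv. rewrite Rmult_assoc, Rinv_l by nra. nra.
  - apply is_lim_const.
  - apply is_lim_ext with (2 := is_lim_pow_exp 1 0 Rlt_0_1). intros t.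
    replace (-1 * t) with (- (1) * t) by ring. simpl. ring.
Qed.

(** The base case is the Gaussian integral under [t = s^2]; the step is [Gamma(a+1) = a Gamma(a)],
    by parts with [t^j sqrt t e^(-t)]. *)
Lemma is_RInt_gen_Gamma_half (j : nat) :
  is_RInt_gen (fun t => t ^ j / sqrt t * exp (- t)) (at_right 0) (Rbar_locally p_infty)
    (pochhammer (1 / 2) j * sqrt PI).
Proof.
  induction j as [|j IH].
  - set (F := fun t => 2 * gauss (sqrt t)).
    replace (pochhammer (1 / 2) 0 * sqrt PI) with (2 * (sqrt PI / 2) - F 0).
    2: { unfold F. rewrite sqrt_0. unfold gauss. rewrite RInt_point.
         unfold zero; simpl. field. }
    apply is_RInt_gen_half_line with F.
    + intros t ht. assert (hs := sqrt_lt_R0 t ht).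
      assert (H := is_derive_gauss (sqrt t)). unfold F. auto_derive.
      { split. eexists; apply H. easy. }
      rewrite (is_derive_unique (fun x0 : R => gauss x0) _ _ H).
      rewrite sqrt_sqrt by lra. simpl. field. lra.
    + intros t ht. assert (hs := sqrt_lt_R0 t ht). continuous_by_derive.
      repeat split; lra.
    + apply continuous_at_right.
      apply (continuous_mult (fun _ => 2)). apply continuous_const.
      apply (continuous_comp sqrt gauss). apply continuous_sqrt.
      apply (ex_derive_continuous (K := R_AbsRing) (V := R_NormedModule)).
      eexists. apply is_derive_gauss.
    + apply (is_lim_scal_l _ 2 p_infty (sqrt PI / 2)).
      apply (is_lim_comp_pinfty gauss sqrt). apply is_lim_gauss.
      apply filterlim_sqrt_p.
  - set (F := fun t => t ^ j * sqrt t * exp (- t)).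
    assert (HF : is_RInt_gen (fun t => (INR j + 1 / 2) * (t ^ j / sqrt t * exp (- t))
        - t ^ S j / sqrt t * exp (- t)) (at_right 0) (Rbar_locally p_infty) (0 - F 0)).
    { apply is_RInt_gen_half_line with F.
      - intros t ht. assert (hs := sqrt_lt_R0 t ht). unfold F. auto_derive. easy.
        assert (Hs : t = sqrt t * sqrt t) by (symmetry; apply sqrt_sqrt; lra).
        set (e := exp (- t)). set (s := sqrt t) in *. clearbody e s. subst t.
        (* The derivative of [t ^ j] has exponent [pred j], so [j = 0] is treated apart. *)
        destruct j as [|j].
        + simpl. field. lra.
        + refold_INR. rewrite S_INR. simpl. field. lra.
      - intros t ht. assert (hs := sqrt_lt_R0 t ht). continuous_by_derive.
        repeat split; lra.
      - apply continuous_at_right. unfold F.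
        apply (continuous_mult (fun t => t ^ j * sqrt t) (fun t => exp (- t))).
        apply (continuous_mult (fun t => t ^ j) sqrt).
        continuous_by_derive. easy. apply continuous_sqrt. continuous_by_derive. easy.
      - apply is_lim_le_le_loc with (fun _ => 0) (fun t => t ^ S j * exp (- (1) * t)).
        + exists 1. intros t ht. assert (hs : 0 < sqrt t) by (apply sqrt_lt_R0; lra).
          assert (Hs : sqrt t * sqrt t = t) by (apply sqrt_sqrt; lra).
          assert (hj : 0 < t ^ j) by (apply pow_lt; lra). assert (he := exp_pos (- t)).
          unfold F. replace (- (1) * t) with (- t) by ring. split.
          * apply Rlt_le, Rmult_lt_0_compat; [apply Rmult_lt_0_compat|]; assumption.
          * apply Rmult_le_compat_r. lra. simpl. rewrite (Rmult_comm t).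
            apply Rmult_le_compat_l; nra.
        + apply is_lim_const.
        + apply is_lim_pow_exp. lra. }
    assert (H := is_RInt_gen_minus _ _ _ _ (is_RInt_gen_scal _ (INR j + 1 / 2) _ IH) HF).
    replace (pochhammer (1 / 2) (S j) * sqrt PI)
      with (minus (scal (INR j + 1 / 2) (pochhammer (1 / 2) j * sqrt PI)) (0 - F 0)).
    2: { unfold F. rewrite sqrt_0. unfold minus, plus, opp, scal; simpl.
         unfold mult; simpl. ring. }
    apply is_RInt_gen_half_line_ext with (2 := H).
    intros t _. unfold minus, plus, opp, scal; simpl. unfold mult; simpl. eq_in_R. ring.
Qed.

Lemma Gamma_pos_half (j : nat) :
  Gamma_pos (INR j + 1 / 2) = pochhammer (1 / 2) j * sqrt PI.
Proof.
  unfold Gamma_pos. apply is_RInt_gen_unique; try (apply Proper_StrongProper; typeclasses eauto).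
  apply is_RInt_gen_half_line_ext with (2 := is_RInt_gen_Gamma_half j).
  intros t ht. f_equal.
  replace (INR j + 1 / 2 - 1) with (INR j + - / 2) by field.
  rewrite Rpower_plus, Rpower_pow, Rpower_Ropp, Rpower_sqrt by assumption. reflexivity.
Qed.

Lemma pochhammer_pos (a : R) (m : nat) : 0 < a -> 0 < pochhammer a m.
Proof.
  intros ha. induction m as [|m IH]; simpl. lra.
  apply Rmult_lt_0_compat. assumption. assert (h := pos_INR m). lra.
Qed.

Lemma pochhammer_succ_l (a : R) (m : nat) :
  pochhammer a (S m) = a * pochhammer (a + 1) m.
Proof.
  induction m as [|m IH]. simpl. ring.
  change (pochhammer a (S (S m))) with (pochhammer a (S m) * (a + INR (S m))).
  rewrite IH, S_INR. simpl. ring.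
Qed.

(** The argument is positive, so [up] of its opposite is at most 0 and the continuation makes no
    shift. *)
Lemma rGamma_half_nat (j : nat) :
  rGamma (INR j + 1 / 2) = / (pochhammer (1 / 2) j * sqrt PI).
Proof.
  unfold rGamma. replace (Z.to_nat (up (- (INR j + 1 / 2)))) with 0%nat.
  - simpl (INR 0). rewrite Rplus_0_r, Gamma_pos_half. simpl. unfold Rdiv. ring.
  - destruct (archimed (- (INR j + 1 / 2))) as [_ H]. assert (h := pos_INR j).
    assert (H1 : IZR (up (- (INR j + 1 / 2))) < IZR 1) by lra.
    apply lt_IZR in H1. lia.
Qed.

(** The shift for [a] is one more than that for [a + 1]; both end at the same positive argument, and
    the Pochhammer product gains the factor [a]. *)
Lemma rGamma_nonpos (a : R) : a <= 0 -> rGamma a = a * rGamma (a + 1).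
Proof.
  intros ha. unfold rGamma.
  assert (Hup : up (- a) = (up (- (a + 1)) + 1)%Z).
  { symmetry. apply tech_up; rewrite plus_IZR;
    destruct (archimed (- (a + 1))); lra. }
  (* Since [- (a + 1) >= -1], its [up] exceeds -1, so [Z.to_nat] truncates nothing. *)
  assert (h : (0 <= up (- (a + 1)))%Z).
  { destruct (archimed (- (a + 1))) as [H _].
    assert (H1 : IZR (-1) < IZR (up (- (a + 1)))) by lra. apply lt_IZR in H1. lia. }
  rewrite Hup, Z2Nat.inj_add by lia. simpl (Z.to_nat 1). rewrite Nat.add_1_r.
  rewrite pochhammer_succ_l, S_INR.
  replace (a + (INR (Z.to_nat (up (- (a + 1)))) + 1))
    with (a + 1 + INR (Z.to_nat (up (- (a + 1))))) by ring.
  unfold Rdiv. ring.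
Qed.

Definition half_integer (a : R) : Prop := exists p : Z, a = IZR p + 1 / 2.

Lemma half_integer_plus (a : R) (p : Z) : half_integer a -> half_integer (a + IZR p).
Proof.
  intros [q ->]. exists (q + p)%Z. rewrite plus_IZR. ring.
Qed.

Lemma half_integer_opp (a : R) : half_integer a -> half_integer (- a).
Proof.
  intros [q ->]. exists (- q - 1)%Z. rewrite minus_IZR, opp_IZR. field.
Qed.

Lemma half_integer_nat (n : nat) : half_integer (INR n + 1 / 2).
Proof. exists (Z.of_nat n). now rewrite INR_IZR_INZ. Qed.

Lemma rGamma_half_integer (a : R) : half_integer a -> rGamma a = a * rGamma (a + 1).
Proof.
  intros [p ->]. destruct (Z_lt_le_dec p 0) as [hp|hp].
  - apply rGamma_nonpos. assert (h : IZR p <= IZR (-1)) by (apply IZR_le; lia). lra.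
  - rewrite <- (Z2Nat.id p hp), <- INR_IZR_INZ. set (j := Z.to_nat p).
    replace (INR j + 1 / 2 + 1) with (INR (S j) + 1 / 2) by (rewrite S_INR; ring).
    rewrite !rGamma_half_nat. simpl pochhammer.
    assert (h := pos_INR j). assert (h1 := pochhammer_pos (1 / 2) j ltac:(lra)).
    assert (h2 : 0 < sqrt PI) by (apply sqrt_lt_R0, PI_RGT_0).
    field. repeat split; lra.
Qed.

(** * Bessel functions of half-integer order *)

Definition BesselI_term (nu z : R) (k : nat) : R :=
  (z / 2) ^ (2 * k) / INR (fact k) * rGamma (nu + INR k + 1).

Lemma BesselI_eq (nu z l : R) :
  is_series (BesselI_term nu z) l -> BesselI nu z = Rpower (z / 2) nu * l.
Proof.
  intros H. unfold BesselI. f_equal. now apply is_series_unique.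
Qed.

Lemma BesselI_term_down_0 (nu z : R) :
  half_integer nu -> BesselI_term (nu - 1) z 0 = nu * BesselI_term nu z 0.
Proof.
  intros H. unfold BesselI_term. simpl (INR 0). rewrite !Rplus_0_r.
  replace (nu - 1 + 1) with nu by ring. rewrite (rGamma_half_integer nu H). ring.
Qed.

(** Write [1/Gamma(nu+k+1) = (nu+k+1)/Gamma(nu+k+2)]. The part [nu] keeps the order, and the part
    [k+1] cancels in [(k+1)!], leaving a term of order [nu + 1]. *)
Lemma BesselI_term_down_S (nu z : R) (k : nat) :
  half_integer nu ->
  BesselI_term (nu - 1) z (S k)
  = nu * BesselI_term nu z (S k) + (z / 2) ^ 2 * BesselI_term (nu + 1) z k.
Proof.
  intros H. unfold BesselI_term.
  replace (nu - 1 + INR (S k) + 1) with (nu + INR (S k)) by ring.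
  rewrite (rGamma_half_integer (nu + INR (S k))).
  2: { rewrite INR_IZR_INZ. now apply half_integer_plus. }
  replace (nu + 1 + INR k + 1) with (nu + INR (S k) + 1) by (rewrite S_INR; ring).
  replace (2 * S k)%nat with (2 + 2 * k)%nat by lia. rewrite pow_add.
  rewrite fact_simpl, mult_INR. assert (h := INR_fact_lt_0 k).
  assert (h1 := lt_0_INR (S k) ltac:(lia)). rewrite (S_INR k) in *. field. lra.
Qed.

Lemma is_series_BesselI_down (nu z a b : R) :
  half_integer nu ->
  is_series (BesselI_term nu z) a -> is_series (BesselI_term (nu + 1) z) b ->
  is_series (BesselI_term (nu - 1) z) (nu * a + (z / 2) ^ 2 * b).
Proof.
  intros H Ha Hb. apply is_series_decr_1.
  apply (is_series_ext (fun k => plus (scal nu (BesselI_term nu z (S k)))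
    (scal ((z / 2) ^ 2) (BesselI_term (nu + 1) z k)))).
  { intros k. rewrite BesselI_term_down_S by assumption. reflexivity. }
  match goal with |- is_series _ ?l => replace l
    with (plus (scal nu (a - BesselI_term nu z 0)) (scal ((z / 2) ^ 2) b)) end.
  2: { rewrite BesselI_term_down_0 by assumption.
       unfold plus, opp, scal; simpl; unfold mult; simpl. ring. }
  apply (is_series_plus (V := R_NormedModule)).
  - apply (is_series_scal_l (V := R_NormedModule)).
    apply is_series_incr_1. unfold plus; simpl.
    now replace (a - BesselI_term nu z 0 + BesselI_term nu z 0) with a by ring.
  - now apply (is_series_scal_l (V := R_NormedModule)).
Qed.

(** Solving the termwise recurrence for the order [nu + 1] carries convergence upwards, as
    [is_series_BesselI_down] carries it downwards. *)
Lemma ex_series_BesselI_up (nu z : R) :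
  0 < z -> half_integer nu ->
  ex_series (BesselI_term (nu - 1) z) -> ex_series (BesselI_term nu z) ->
  ex_series (BesselI_term (nu + 1) z).
Proof.
  intros hz H Ha Hb.
  assert (Hw : (z / 2) ^ 2 <> 0) by (apply pow_nonzero; lra).
  apply ex_series_incr_1 in Ha. apply ex_series_incr_1 in Hb.
  apply (ex_series_ext (fun k => scal (/ (z / 2) ^ 2)
    (minus (BesselI_term (nu - 1) z (S k)) (scal nu (BesselI_term nu z (S k)))))).
  { intros k. rewrite BesselI_term_down_S by assumption.
    change (/ (z / 2) ^ 2 * (nu * BesselI_term nu z (S k)
      + (z / 2) ^ 2 * BesselI_term (nu + 1) z k - nu * BesselI_term nu z (S k))
      = BesselI_term (nu + 1) z k). field. lra. }
  apply (ex_series_scal_l (V := R_NormedModule)).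
  apply (ex_series_minus (V := R_NormedModule)). assumption.
  now apply (ex_series_scal_l (V := R_NormedModule)).
Qed.

(** The duplication formula, which turns the series of order [-1/2] and [1/2] into exponential
    ones. *)
Lemma fact_double (k : nat) :
  INR (fact (2 * k)) = 4 ^ k * INR (fact k) * pochhammer (1 / 2) k.
Proof.
  induction k as [|k IH]. simpl. ring.
  replace (2 * S k)%nat with (S (S (2 * k))) by lia.
  rewrite !fact_simpl, !mult_INR, IH, !S_INR, mult_INR. simpl. field.
Qed.

Lemma fact_double_succ (k : nat) :
  INR (fact (2 * k + 1)) = 2 * 4 ^ k * INR (fact k) * pochhammer (1 / 2) (S k).
Proof.
  rewrite Nat.add_1_r, fact_simpl, mult_INR, fact_double, S_INR, mult_INR. simpl. field.
Qed.

Lemma BesselI_term_neg_half (z : R) (k : nat) :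
  BesselI_term (- (1 / 2)) z k = / sqrt PI * ((z ^ 2) ^ k * / INR (fact (2 * k))).
Proof.
  unfold BesselI_term.
  replace (- (1 / 2) + INR k + 1) with (INR k + 1 / 2) by field.
  rewrite rGamma_half_nat, fact_double, pow_mult.
  replace ((z / 2) ^ 2) with (z ^ 2 * / 4) by field.
  rewrite Rpow_mult_distr, pow_inv.
  assert (h := INR_fact_lt_0 k). assert (h1 := pochhammer_pos (1 / 2) k ltac:(lra)).
  assert (h2 : 0 < sqrt PI) by (apply sqrt_lt_R0, PI_RGT_0).
  assert (h3 : 0 < 4 ^ k) by (apply pow_lt; lra).
  field. repeat split; lra.
Qed.

Lemma BesselI_term_half (z : R) (k : nat) :
  BesselI_term (1 / 2) z k = 2 / sqrt PI * ((z ^ 2) ^ k * / INR (fact (2 * k + 1))).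
Proof.
  unfold BesselI_term.
  replace (1 / 2 + INR k + 1) with (INR (S k) + 1 / 2) by (rewrite S_INR; field).
  rewrite rGamma_half_nat, fact_double_succ, pow_mult.
  replace ((z / 2) ^ 2) with (z ^ 2 * / 4) by field.
  rewrite Rpow_mult_distr, pow_inv.
  assert (h := INR_fact_lt_0 k). assert (h1 := pochhammer_pos (1 / 2) (S k) ltac:(lra)).
  assert (h2 : 0 < sqrt PI) by (apply sqrt_lt_R0, PI_RGT_0).
  assert (h3 : 0 < 4 ^ k) by (apply pow_lt; lra).
  field. repeat split; lra.
Qed.

Lemma ex_series_fact_le (y : R) (p : nat -> nat) :
  0 <= y -> (forall k, (k <= p k)%nat) -> ex_series (fun k => y ^ k * / INR (fact (p k))).
Proof.
  intros hy hp.
  apply (ex_series_le (V := R_CompleteNormedModule) _ (fun k => y ^ k * / INR (fact k))).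
  - intros k. change (Rabs (y ^ k * / INR (fact (p k))) <= y ^ k * / INR (fact k)).
    assert (h := INR_fact_lt_0 k). assert (h' := INR_fact_lt_0 (p k)).
    assert (hk := pow_le y k hy).
    rewrite Rabs_pos_eq.
    2: { apply Rmult_le_pos; [assumption|]. now apply Rlt_le, Rinv_0_lt_compat. }
    apply Rmult_le_compat_l. assumption.
    apply Rinv_le_contravar. assumption. apply le_INR, fact_le, hp.
  - exists (exp y). generalize (is_exp_Reals y).
    apply is_series_ext. intros k. rewrite pow_n_pow. reflexivity.
Qed.

(** The witnesses are [c = cosh z] and [s = sinh z / z], obtained as sums of series; they are the
    even and odd parts of the exponential series at [- z]. *)
Lemma is_series_BesselI_half (z : R) :
  0 < z ->
  exists c s, is_series (BesselI_term (- (1 / 2)) z) (/ sqrt PI * c)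
    /\ is_series (BesselI_term (1 / 2) z) (2 / sqrt PI * s) /\ c - z * s = exp (- z).
Proof.
  intros hz.
  destruct (ex_series_fact_le (z ^ 2) (fun k => 2 * k)%nat) as [c Hc].
  { apply pow_le. lra. } { intros k. lia. }
  destruct (ex_series_fact_le (z ^ 2) (fun k => 2 * k + 1)%nat) as [s Hs].
  { apply pow_le. lra. } { intros k. lia. }
  exists c, s. split; [|split].
  - apply (is_series_ext (fun k => scal (/ sqrt PI) ((z ^ 2) ^ k * / INR (fact (2 * k))))).
    intros k. symmetry. apply BesselI_term_neg_half.
    now apply (is_series_scal_l (V := R_NormedModule)).
  - apply (is_series_ext (fun k => scal (2 / sqrt PI) ((z ^ 2) ^ k * / INR (fact (2 * k + 1))))).
    intros k. symmetry. apply BesselI_term_half.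
    now apply (is_series_scal_l (V := R_NormedModule)).
  - assert (H : is_pseries (fun n => / INR (fact n)) (- z) (c + - z * s)).
    { apply is_pseries_odd_even; replace ((- z) ^ 2) with (z ^ 2) by ring;
        [generalize Hc|generalize Hs]; apply is_series_ext;
        intros k; rewrite <- (pow_n_pow (z ^ 2) k); reflexivity. }
    apply is_pseries_unique in H.
    rewrite (is_pseries_unique _ _ _ (is_exp_Reals (- z))) in H. lra.
Qed.

Lemma ex_series_BesselI_term (nu z : R) :
  0 < z -> half_integer nu -> ex_series (BesselI_term nu z).
Proof.
  intros hz.
  assert (h0 : half_integer (1 / 2)) by (exists 0%Z; ring).
  destruct (is_series_BesselI_half z hz) as (c & s & Hc & Hs & _).
  (* The recurrence has three terms, so each induction carries two consecutive orders, starting from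
     [-1/2] and [1/2]. *)
  assert (Hup : forall n, ex_series (BesselI_term (- (1 / 2) + INR n) z)
                       /\ ex_series (BesselI_term (1 / 2 + INR n) z)).
  { induction n as [|n [IH1 IH2]].
    - simpl. rewrite !Rplus_0_r. split; eexists; [exact Hc|exact Hs].
    - replace (- (1 / 2) + INR (S n)) with (1 / 2 + INR n) by (rewrite S_INR; field).
      split. assumption.
      replace (1 / 2 + INR (S n)) with (1 / 2 + INR n + 1) by (rewrite S_INR; field).
      apply ex_series_BesselI_up.
      + exact hz.
      + rewrite INR_IZR_INZ. now apply half_integer_plus.
      + replace (1 / 2 + INR n - 1) with (- (1 / 2) + INR n) by field. exact IH1.
      + exact IH2. }
  assert (Hdown : forall n, ex_series (BesselI_term (- (1 / 2) - INR n) z)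
                         /\ ex_series (BesselI_term (1 / 2 - INR n) z)).
  { induction n as [|n [[a IH1] [b IH2]]].
    - simpl. rewrite !Rminus_0_r. split; eexists; [exact Hc|exact Hs].
    - replace (1 / 2 - INR (S n)) with (- (1 / 2) - INR n) by (rewrite S_INR; field).
      split; [|now exists a].
      replace (- (1 / 2) - INR (S n)) with (- (1 / 2) - INR n - 1) by (rewrite S_INR; ring).
      eexists. apply is_series_BesselI_down.
      + replace (- (1 / 2) - INR n) with (- (INR n + 1 / 2)) by ring.
        apply half_integer_opp, half_integer_nat.
      + exact IH1.
      + replace (- (1 / 2) - INR n + 1) with (1 / 2 - INR n) by field. exact IH2. }
  intros [p ->]. destruct (Z_le_gt_dec 0 p) as [hp|hp].
  - rewrite <- (Z2Nat.id p hp), <- INR_IZR_INZ, Rplus_comm. apply Hup.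
  - replace p with (- Z.of_nat (Z.to_nat (- p)))%Z by lia.
    rewrite opp_IZR, <- INR_IZR_INZ, Rplus_comm. apply Hdown.
Qed.

Lemma BesselI_recurrence (nu z : R) :
  0 < z -> half_integer nu ->
  BesselI (nu - 1) z = 2 * nu / z * BesselI nu z + BesselI (nu + 1) z.
Proof.
  intros hz H.
  destruct (ex_series_BesselI_term nu z hz H) as [a Ha].
  destruct (ex_series_BesselI_term (nu + 1) z hz (half_integer_plus nu 1 H)) as [b Hb].
  assert (Hc := is_series_BesselI_down nu z a b H Ha Hb).
  rewrite (BesselI_eq _ _ _ Ha), (BesselI_eq _ _ _ Hb), (BesselI_eq _ _ _ Hc).
  unfold Rminus. rewrite !Rpower_plus, Rpower_Ropp, Rpower_1 by lra. field. lra.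
Qed.

Lemma BesselK_quot_opp (nu z : R) : BesselK_quot (- nu) z = BesselK_quot nu z.
Proof.
  unfold BesselK_quot. rewrite Ropp_involutive.
  replace (- nu * PI) with (- (nu * PI)) by ring. rewrite sin_neg.
  unfold Rdiv. rewrite Rinv_opp. ring.
Qed.

(** Use the recurrence of [BesselI] at [nu] and at [- nu]; the sine changes sign under a shift of
    the order by 1, which turns the difference into a sum. *)
Lemma BesselK_quot_recurrence (nu z : R) :
  0 < z -> half_integer nu ->
  BesselK_quot (nu + 1) z = BesselK_quot (nu - 1) z + 2 * nu / z * BesselK_quot nu z.
Proof.
  intros hz H. unfold BesselK_quot.
  assert (H1 := BesselI_recurrence nu z hz H).
  assert (H2 := BesselI_recurrence (- nu) z hz (half_integer_opp nu H)).
  replace (- (nu + 1)) with (- nu - 1) by ring.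
  replace (- (nu - 1)) with (- nu + 1) by ring.
  replace ((nu + 1) * PI) with (nu * PI + PI) by ring.
  assert (Hs : sin ((nu - 1) * PI) = - sin (nu * PI)).
  { replace (nu * PI) with ((nu - 1) * PI + PI) by ring. rewrite neg_sin. ring. }
  rewrite Hs, neg_sin, H1, H2. unfold Rdiv. rewrite Rinv_opp. ring.
Qed.

Lemma BesselK_quot_half (z : R) :
  0 < z -> BesselK_quot (1 / 2) z = sqrt PI / (2 * sqrt (z / 2)) * exp (- z).
Proof.
  intros hz. destruct (is_series_BesselI_half z hz) as (c & s & Hc & Hs & H).
  unfold BesselK_quot. rewrite (BesselI_eq _ _ _ Hc), (BesselI_eq _ _ _ Hs).
  replace (1 / 2 * PI) with (PI / 2) by field. rewrite sin_PI2.
  rewrite Rpower_Ropp. replace (1 / 2) with (/ 2) by field.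
  rewrite Rpower_sqrt by lra. rewrite <- H.
  assert (hP := sqrt_lt_R0 PI PI_RGT_0). assert (hy := sqrt_lt_R0 (z / 2) ltac:(lra)).
  assert (HP : PI = sqrt PI * sqrt PI) by (symmetry; apply sqrt_sqrt, Rlt_le, PI_RGT_0).
  assert (Hz : z = 2 * (sqrt (z / 2) * sqrt (z / 2))) by (rewrite sqrt_sqrt; lra).
  set (p := sqrt PI) in *. set (y := sqrt (z / 2)) in *. clearbody p y.
  rewrite HP, Hz. field.  lra.
Qed.

(* Extended by zero for [n < k], where [n - k] would be truncated. *)
Definition bessel_coef (n k : nat) : R :=
  if (k <=? n)%nat then INR (fact (n + k)) / (INR (fact k) * INR (fact (n - k))) else 0.

Lemma bessel_coef_0 (n : nat) : bessel_coef n 0 = 1.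
Proof.
  unfold bessel_coef. simpl (0 <=? n)%nat. rewrite Nat.sub_0_r, Nat.add_0_r. simpl.
  field. apply INR_fact_neq_0.
Qed.

Lemma bessel_coef_recurrence (n k : nat) :
  (k <= S n)%nat ->
  bessel_coef (S (S n)) (S k)
  = bessel_coef n (S k) + 2 * INR (2 * n + 3) * bessel_coef (S n) k.
Proof.
  intros hk. unfold bessel_coef.
  rewrite (proj2 (Nat.leb_le (S k) (S (S n)))), (proj2 (Nat.leb_le k (S n))) by lia.
  assert (hf := INR_fact_lt_0).
  (* Beyond [S k <= n] there remain [k = n] and [k = S n], where the coefficient of degree [n] is
     the zero extension. *)
  destruct (Nat.leb_spec (S k) n) as [h|h]; [|destruct (Nat.eq_dec k n) as [->|h']].
  - destruct (Nat.le_exists_sub _ _ h) as (r & -> & _).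
    replace (S (S (r + S k)) - S k)%nat with (S (S r)) by lia.
    replace (S (r + S k) - k)%nat with (S (S r)) by lia.
    replace (r + S k - S k)%nat with r by lia.
    replace (S (S (r + S k)) + S k)%nat with (S (S (r + S k + S k))) by lia.
    replace (S (r + S k) + k)%nat with (r + S k + S k)%nat by lia.
    rewrite (fact_simpl (S (r + S k + S k))), (fact_simpl (r + S k + S k)).
    rewrite (fact_simpl (S r)), (fact_simpl r), (fact_simpl k), !mult_INR.
    assert (h1 := hf r). assert (h2 := hf k). assert (h3 := hf (r + S k + S k)%nat).
    set (f := INR (fact (r + S k + S k))) in *.
    repeat rewrite ?S_INR, ?plus_INR, ?mult_INR. simpl (INR 0).
    assert (h4 := pos_INR r). assert (h5 := pos_INR k). simpl. field. repeat split; lra.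
  - replace (S (S n) - S n)%nat with 1%nat by lia.
    replace (S n - n)%nat with 1%nat by lia.
    replace (S (S n) + S n)%nat with (S (S (S n + n))) by lia.
    rewrite (fact_simpl (S (S n + n))), (fact_simpl (S n + n)), (fact_simpl n), !mult_INR.
    assert (h1 := hf n). assert (h2 := hf (S n + n)%nat).
    set (f := INR (fact (S n + n))) in *.
    repeat rewrite ?S_INR, ?plus_INR, ?mult_INR.
    assert (h4 := pos_INR n). simpl. field. repeat split; lra.
  - assert (k = S n) by lia. subst k. rewrite !Nat.sub_diag.
    replace (S (S n) + S (S n))%nat with (S (S (S n + S n))) by lia.
    rewrite (fact_simpl (S (S n + S n))), (fact_simpl (S n + S n)), (fact_simpl (S n)), !mult_INR.
    assert (h1 := hf (S n)). assert (h2 := hf (S n + S n)%nat).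
    set (f := INR (fact (S n + S n))) in *. set (g := INR (fact (S n))) in *.
    repeat rewrite ?S_INR, ?plus_INR, ?mult_INR.
    assert (h4 := pos_INR n). simpl. field. repeat split; lra.
Qed.

(** The classical Bessel polynomial [y_n], evaluated at [2 y]. *)
Definition bessel_poly (n : nat) (y : R) : R := sum_n (fun k => bessel_coef n k * y ^ k) n.

Lemma bessel_poly_recurrence (n : nat) (y : R) :
  bessel_poly (S (S n)) y
  = bessel_poly n y + 2 * INR (2 * n + 3) * y * bessel_poly (S n) y.
Proof.
  (* Padding with zero coefficients gives all sums the same range; the constant terms are all 1, and
     the rest is compared coefficientwise. *)
  assert (Hn : bessel_poly n y = sum_n (fun k => bessel_coef n k * y ^ k) (S (S n))).
  { rewrite !sum_Sn. unfold bessel_coef at 2 3.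
    rewrite (proj2 (Nat.leb_gt (S n) n)), (proj2 (Nat.leb_gt (S (S n)) n)) by lia.
    rewrite !Rmult_0_l. change (bessel_poly n y = bessel_poly n y + 0 + 0). ring. }
  rewrite Hn. unfold bessel_poly, sum_n. rewrite !(sum_Sn_m _ 0 (S (S n))) by lia.
  rewrite <- !sum_n_m_S, !bessel_coef_0.
  change (1 * y ^ 0 + sum_n (fun k => bessel_coef (S (S n)) (S k) * y ^ S k) (S n)
    = 1 * y ^ 0 + sum_n (fun k => bessel_coef n (S k) * y ^ S k) (S n)
      + 2 * INR (2 * n + 3) * y * sum_n (fun k => bessel_coef (S n) k * y ^ k) (S n)).
  rewrite Rplus_assoc, <- sum_n_Rmult_l. f_equal.
  rewrite <- sum_n_Rplus. apply sum_n_ext_loc. intros k hk.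
  rewrite bessel_coef_recurrence by assumption.
  rewrite <- tech_pow_Rmult. eq_in_R. ring.
Qed.

Lemma BesselK_quot_half_integer (n : nat) (z : R) :
  0 < z ->
  BesselK_quot (INR n + 1 / 2) z = BesselK_quot (1 / 2) z * bessel_poly n (/ (2 * z)).
Proof.
  intros hz.
  assert (H : BesselK_quot (INR n + 1 / 2) z = BesselK_quot (1 / 2) z * bessel_poly n (/ (2 * z))
   /\ BesselK_quot (INR (S n) + 1 / 2) z
      = BesselK_quot (1 / 2) z * bessel_poly (S n) (/ (2 * z))).
  2: apply H.
  induction n as [|n [IH1 IH2]].
  - split.
    + unfold bessel_poly. rewrite sum_O, bessel_coef_0. simpl. rewrite Rplus_0_l. ring.
    (* The recurrence at [nu = 1/2] involves the order [-1/2], which symmetry returns to [1/2]. *)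
    + replace (INR 1 + 1 / 2) with (1 / 2 + 1) by (simpl; ring).
      rewrite BesselK_quot_recurrence; [|assumption|exists 0%Z; ring].
      replace (1 / 2 - 1) with (- (1 / 2)) by field. rewrite BesselK_quot_opp.
      unfold bessel_poly. rewrite sum_Sn, sum_O, bessel_coef_0.
      unfold bessel_coef, plus; simpl. field. lra.
  - split. assumption.
    replace (INR (S (S n)) + 1 / 2) with (INR (S n) + 1 / 2 + 1) by (rewrite !S_INR; ring).
    rewrite BesselK_quot_recurrence; [|assumption|apply half_integer_nat].
    replace (INR (S n) + 1 / 2 - 1) with (INR n + 1 / 2) by (rewrite S_INR; ring).
    rewrite IH1, IH2, bessel_poly_recurrence, S_INR, plus_INR, mult_INR. simpl. field. lra.
Qed.

Lemma sin_half_integer (n : nat) : sin ((INR n + 1 / 2) * PI) <> 0.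
Proof.
  induction n as [|n IH].
  - replace ((INR 0 + 1 / 2) * PI) with (PI / 2) by (simpl; field). rewrite sin_PI2. lra.
  - replace ((INR (S n) + 1 / 2) * PI) with ((INR n + 1 / 2) * PI + PI)
      by (rewrite S_INR; ring).
    rewrite neg_sin. lra.
Qed.

(** The prefactor turns the value at order [1/2] into [n! / x^(n+1)], the polynomial is taken at
    [1/x], and [n! (n+k)! / (k! (n-k)!)] is [C(n, k) (n+k)!]. *)
Lemma BesselK_half_integer (n : nat) (x : R) :
  0 < x ->
  INR (fact n) * exp (x / 2) / (sqrt PI * Rpower x (INR n + 1 / 2))
    * BesselK (INR n + 1 / 2) (x / 2)
  = sum_n (fun k => Binomial.C n k * (INR (fact (n + k)) / x ^ (n + k + 1))) n.
Proof.
  intros hx. unfold BesselK.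
  destruct (Req_EM_T _ 0) as [h|_]; [now destruct (sin_half_integer n)|].
  rewrite BesselK_quot_half_integer, BesselK_quot_half by lra.
  replace (2 * (x / 2)) with x by field.
  assert (hX : 0 < x ^ n) by now apply pow_lt.
  assert (hs := sqrt_lt_R0 x hx).
  assert (hP := sqrt_lt_R0 PI PI_RGT_0).
  replace (INR n + 1 / 2) with (INR n + / 2) by field.
  rewrite Rpower_plus, Rpower_pow, Rpower_sqrt, exp_Ropp by assumption.
  replace (sqrt (x / 2 / 2)) with (sqrt x / 2).
  2: { replace (x / 2 / 2) with (x * (/ 2 * / 2)) by field.
       rewrite sqrt_mult, sqrt_square by lra. reflexivity. }
  assert (he := exp_pos (x / 2)).
  replace (INR (fact n) * exp (x / 2) / (sqrt PI * (x ^ n * sqrt x)) *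
     (sqrt PI / (2 * (sqrt x / 2)) * / exp (x / 2) * bessel_poly n (/ x)))
    with (INR (fact n) / (x ^ n * (sqrt x * sqrt x)) * bessel_poly n (/ x))
    by (field; repeat split; lra).
  rewrite sqrt_sqrt by lra. unfold bessel_poly. rewrite <- sum_n_Rmult_l.
  apply sum_n_ext_loc. intros k hk. unfold bessel_coef, Binomial.C.
  rewrite (proj2 (Nat.leb_le k n)) by assumption.
  replace (n + k + 1)%nat with (S (n + k)) by lia.
  rewrite pow_inv, <- tech_pow_Rmult, pow_add.
  assert (hk' : 0 < x ^ k) by now apply pow_lt.
  assert (h1 := INR_fact_lt_0 k). assert (h2 := INR_fact_lt_0 (n - k)).
  eq_in_R. field. repeat split; lra.
Qed.

(** * Binomial expansion and assembly *)

Lemma binomial_log_integrand (n : nat) (x t : R) :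
  0 < t ->
  sum_n (fun k => Binomial.C n k * (exp (- x * t) * t ^ (n + k) * Lg t)) n
  = exp (- x * t) * Rpower t (INR n + 1 / 2 - 0 - 1 / 2)
    * Rpower (1 + t) (INR n + 1 / 2 + 0 - 1 / 2) * ln ((1 + t) / t).
Proof.
  intros ht.
  (* Both exponents equal [n], so the powers are [t^n (1 + t)^n], and [(1 + t)^n] is expanded. *)
  replace (INR n + 1 / 2 - 0 - 1 / 2) with (INR n) by ring.
  replace (INR n + 1 / 2 + 0 - 1 / 2) with (INR n) by ring.
  rewrite !Rpower_pow by lra. rewrite (Rplus_comm 1 t) at 1.
  rewrite binomial, <- sum_n_Reals, <- sum_n_Rmult_l, <- sum_n_Rmult_r.
  apply sum_n_ext. intros k. unfold Lg. rewrite pow_add, pow1. eq_in_R. ring.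
Qed.

Theorem theorem19 (n : nat) (x : R) (hx : 0 < x) :
  I1star 0 (INR n + 1 / 2) x =
    INR (fact n) * exp (x / 2) / (sqrt PI * Rpower x (INR n + 1 / 2))
      * BesselK (INR n + 1 / 2) (x / 2) * Ein x
    + sum_n (fun k : nat =>
        Binomial.C n k * (INR (fact (n + k)) / x ^ (n + k + 1))
        * ((-1) ^ (n + k + 1)
             * upper_gamma (- Z.of_nat n - Z.of_nat k) x
             * lower_gamma (Z.of_nat n + Z.of_nat k + 1) (- x)
           - harmonic (n + k)
           - sum_n_m (fun l : nat =>
               Binomial.C (n + k) l * powerRZ (- x) (- Z.of_nat l)
               * lower_gamma (Z.of_nat l) x) 1 (n + k))) n.
Proof.
  (* The middle term is the binomial sum of moments: analysis leads to it from the left side,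
     algebra from the right. *)
  transitivity (sum_n (fun k => Binomial.C n k * log_moment (n + k) x) n).
  - unfold I1star. apply is_RInt_gen_unique; try (apply Proper_StrongProper; typeclasses eauto).
    apply is_RInt_gen_half_line_ext with (1 := binomial_log_integrand n x).
    apply (is_RInt_gen_sum_n _ _). intros k.
    apply (is_RInt_gen_scal (V := R_NormedModule)). now apply is_RInt_gen_log_moment.
  - rewrite BesselK_half_integer, <- sum_n_Rmult_r by assumption.
    rewrite <- sum_n_Rplus.
    apply sum_n_ext. intros k. unfold log_moment, gamma_sum.
    replace (n + k + 1)%nat with (S (n + k)) by lia.
    replace (- Z.of_nat n - Z.of_nat k)%Z with (- Z.of_nat (n + k))%Z by lia.
    replace (Z.of_nat n + Z.of_nat k + 1)%Z with (Z.of_nat (S (n + k))) by lia.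
    eq_in_R. ring.
Qed.
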